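(* Assume (LipS), (SmS* ) and (SCS* ). Consider Algorithm 3: given $x^{(0)}$, $0<\delta<1$, $0<\epsilon<1$, $0<\epsilon_0<1$, at each iteration $k$: draw a sample $\mathcal S_0$ of size $\ge16(K^* )^2\ln(2p/\delta)/((\gamma^* )^2\epsilon_0^2)$ and form $H_0(x^{(k)})$ from it; choose a threshold $\lambda^{(k)}$; draw an independent sample $\mathcal S$ of size $\ge16(K^* )^2\ln(2p/\delta)/((\gamma^* )^2\epsilon^2)$ and form $H(x^{(k)})$ from it; set $\hat H(x^{(k)})=\mathcal P(\lambda^{(k)};H(x^{(k)}))$ and let $x^{(k+1)}$ be given by the update with $\mathbf g=\nabla F(x^{(k)})$, $M=\hat H(x^{(k)})$, $\alpha_k=1$. If $\|x^{(0)}-x^*\|<\frac{\gamma^*}{6(\sqrt p+1/2)L}$, $\epsilon\le1/6$, and at every iteration $$\lambda^{(k)}>\Big(\frac{(6\sqrt p+3)(1-\epsilon)}{(6\sqrt p+2)(1-\epsilon_0)}\Big)\lambda_{\min}\big(H_0(x^{(k)})\big),$$ then for $k_0\ge1$, with probability $(1-\delta)^{2k_0}$, $$\|x^{(k)}-x^*\|\le\rho^{(k-1)}\|x^{(k-1)}-x^*\|,\quad k=1,\dots,k_0,\qquad\text{where }\rho^{(k)}=1-\frac{\gamma^*}{2\lambda^{(k)}}.$$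
   Context: $f_1,\dots,f_n$ are twice differentiable real functions with domains $\mathrm{dom}(f_i)\subseteq\mathbb R^p$; $\mathcal D=\bigcap_i\mathrm{dom}(f_i)$ is open and convex, $\mathcal X\subseteq\mathbb R^p$ is convex, $F=\frac1n\sum_{i=1}^n f_i$, and $x^*$ is a local minimum of $F$ over $\mathcal D\cap\mathcal X$. $\|\cdot\|$ is the Euclidean/spectral norm and $\lambda_{\min}$ the usual smallest eigenvalue. (LipS): there is $L>0$ with $\|\nabla^2f_i(x)-\nabla^2f_i(x^* )\|\le L\|x-x^*\|$ for all $x\in\mathcal D\cap\mathcal X$ and all $i$. (SmS* ): $K^*:=\max_i\|\nabla^2 f_i(x^* )\|<\infty$. (SCS* ): $\gamma^*:=\lambda_{\min}(\nabla^2F(x^* ))>0$. Sub-sampled Hessian: for a collection $\mathcal S$ of indices drawn uniformly at random from $\{1,\dots,n\}$, $H(x)=\frac1{|\mathcal S|}\sum_{j\in\mathcal S}\nabla^2f_j(x)$. Spectral regularization: for symmetric $H=\sum_i\lambda_i(H)v_iv_i^T$, $\mathcal P(\lambda;H)=\sum_{i=1}^p\max\{\lambda_i(H),\lambda\}v_iv_i^T$. Update: $x^{(k+1)}=\arg\min_{x\in\mathcal D\cap\mathcal X}\{F(x^{(k)})+(x-x^{(k)})^T\mathbf g+\frac1{2\alpha_k}(x-x^{(k)})^TM(x-x^{(k)})\}$.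
   Formalization: The starting point x^(0) is additionally assumed to lie in D∩X; without this (LipS), which is only assumed on D∩X, says nothing about the first step and the claim can fail. *)

(* Defs.v *)
From HB Require Import structures.
From mathcomp Require Import all_boot all_order all_algebra.
From mathcomp Require Import all_classical all_reals all_analysis.
Set Implicit Arguments. Unset Strict Implicit. Unset Printing Implicit Defensive.
Import Order.TTheory GRing.Theory Num.Theory.
Import numFieldNormedType.Exports.
Local Open Scope classical_set_scope.
Local Open Scope ring_scope.

Section Defs.
Variables (R : realType) (p : nat).

Definition enorm (v : 'cV[R]_p) : R := Num.sqrt (\sum_(i < p) v i ord0 ^+ 2).

Definition specnorm (A : 'M[R]_p) : R :=
  sup [set enorm (A *m v) | v in [set v : 'cV[R]_p | enorm v <= 1]].

Definition lmin (A : 'M[R]_p) : R := inf [set a : R | eigenvalue A a].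

Definition convex_in (A : set 'cV[R]_p) : Prop :=
  forall x y (t : R), A x -> A y -> 0 <= t <= 1 -> A (t *: x + (1 - t) *: y).

Definition ebasis (i : 'I_p) : 'cV[R]_p := delta_mx i ord0.

Definition grad (f : 'cV[R]_p -> R) (x : 'cV[R]_p) : 'cV[R]_p :=
  \col_i ('d f x (ebasis i)).

Definition Hess (f : 'cV[R]_p -> R) (x : 'cV[R]_p) : 'M[R]_p :=
  \matrix_(i, j) ('d (grad f) x (ebasis j)) i ord0.

Definition twice_diff_on (D : set 'cV[R]_p) (f : 'cV[R]_p -> R) : Prop :=
  forall x, D x -> differentiable f x /\ differentiable (grad f) x.

(* Spectral regularization: M = P(lam; H), i.e. for an orthonormal
   eigen-decomposition H = sum_i d_i v_i v_i^T (V has columns v_i),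
   M = sum_i max(d_i, lam) v_i v_i^T. *)
Definition spec_reg (lam : R) (H M : 'M[R]_p) : Prop :=
  exists (V : 'M[R]_p) (d : 'rV[R]_p),
    V^T *m V = 1%:M /\
    H = V *m diag_mx d *m V^T /\
    M = V *m diag_mx (\row_i Num.max (d ord0 i) lam) *m V^T.

(* the quadratic model of the update (alpha_k = 1) *)
Definition qmodel (Fxk : R) (xk g : 'cV[R]_p) (M : 'M[R]_p) (x : 'cV[R]_p) : R :=
  Fxk + ((x - xk)^T *m g) ord0 ord0 + 2^-1 * ((x - xk)^T *m M *m (x - xk)) ord0 ord0.

Definition is_argmin (C : set 'cV[R]_p) (phi : 'cV[R]_p -> R) (x : 'cV[R]_p) : Prop :=
  C x /\ forall y, C y -> phi x <= phi y.

Section Finite.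
Variable n : nat.
Variable f : 'I_n -> 'cV[R]_p -> R.

Definition Favg (x : 'cV[R]_p) : R := n%:R^-1 * \sum_(i < n) f i x.

Definition subHess (m : nat) (S : m.-tuple 'I_n) (x : 'cV[R]_p) : 'M[R]_p :=
  m%:R^-1 *: \sum_(t < m) Hess (f (tnth S t)) x.

Definition Kstar (xs : 'cV[R]_p) : R := \big[Num.max/0]_(i < n) specnorm (Hess (f i) xs).
Definition gammastar (xs : 'cV[R]_p) : R := lmin (Hess Favg xs).
End Finite.

Definition local_min_on (C : set 'cV[R]_p) (F : 'cV[R]_p -> R) (xs : 'cV[R]_p) : Prop :=
  C xs /\ \forall y \near xs, C y -> F xs <= F y.

End Defs.

(* outcome space of k0 iterations: at iteration k, a pair of independent
   uniform samples (S0, S) of sizes s0 k and s k (with replacement) *)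
Definition Omega (n k0 : nat) (s0 s : nat -> nat) : finType :=
  {dffun forall k : 'I_k0, ((s0 k).-tuple 'I_n * (s k).-tuple 'I_n)%type}.

(* Main.v *)
(* The Hessian samples are only concentrated at the minimizer xs, where the good
   events do not depend on the iterates: the probability of all of them is then a plain
   product over the iterations, and (LipS) transfers the estimates to x^(k).

   Concentration.  For Y the sum of the m centred samples, resampling one coordinate
   gives an exchangeable pair, and the trace inequality
     tr (Y-Z)(Y^N - Z^N) <= N/2 tr (Y-Z)^2 (Y^(N-1) + Z^(N-1))   (N odd),
   read off the eigenbases of Y and Z, yields E tr Y^(2q+2) <= 2m(2q+1)K^2 E tr Y^(2q).
   Hence E tr exp(Y^2/(6mK^2)) <= 2p, and a deviation beyond mt has probability at most
   2p exp(-m t^2/(6K^2)).  With t = (5/8) eps gamma the prescribed sample size makes this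
   at most delta.

   One step.  Write e, e+ for the errors before and after the update and G for the
   Hessian of F at xs.  The first-order conditions at x^(k+1) and at xs give
     lambda |e+|^2 <= e+^T M e+ <= e+^T (M - G) e + L/2 |e|^2 |e+|,
   and M - G splits into M - H(x^(k)), H(x^(k)) - H(xs) and H(xs) - G. *)
Require Import Defs.
From HB Require Import structures.
From mathcomp Require Import all_boot all_order all_algebra.
From mathcomp Require Import all_classical all_reals all_analysis.
From mathcomp Require Import complex.
From mathcomp Require Import ring lra.
Set Implicit Arguments.
Unset Strict Implicit.
Unset Printing Implicit Defensive.
Import Order.TTheory GRing.Theory Num.Theory.
Import numFieldNormedType.Exports.
Local Open Scope classical_set_scope.
Local Open Scope ring_scope.

(** * Inner product, norm and bounds on bilinear forms *)

Section EuclideanForms.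
Context {R : realType} {p : nat}.
Implicit Types (u v w : 'cV[R]_p) (A B : 'M[R]_p).

Definition dot u v : R := (u^T *m v) ord0 ord0.

Lemma dotE u v : dot u v = \sum_i u i ord0 * v i ord0.
Proof. by rewrite /dot mxE; apply: eq_bigr => i _; rewrite mxE. Qed.

Lemma dotC u v : dot u v = dot v u.
Proof. by rewrite !dotE; apply: eq_bigr => i _; rewrite mulrC. Qed.

Lemma dotDl u v w : dot (u + v) w = dot u w + dot v w.
Proof. by rewrite /dot linearD /= mulmxDl mxE. Qed.

Lemma dotDr u v w : dot u (v + w) = dot u v + dot u w.
Proof. by rewrite /dot mulmxDr mxE. Qed.

Lemma dotZl a u v : dot (a *: u) v = a * dot u v.
Proof. by rewrite /dot linearZ /= -scalemxAl mxE. Qed.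

Lemma dotZr a u v : dot u (a *: v) = a * dot u v.
Proof. by rewrite /dot -scalemxAr mxE. Qed.

Lemma dotNl u v : dot (- u) v = - dot u v.
Proof. by rewrite -scaleN1r dotZl mulN1r. Qed.

Lemma dotNr u v : dot u (- v) = - dot u v.
Proof. by rewrite -scaleN1r dotZr mulN1r. Qed.

Lemma dotBl u v w : dot (u - v) w = dot u w - dot v w.
Proof. by rewrite dotDl dotNl. Qed.

Lemma dotBr u v w : dot u (v - w) = dot u v - dot u w.
Proof. by rewrite dotDr dotNr. Qed.

Lemma dot0r u : dot u 0 = 0.
Proof. by rewrite /dot mulmx0 mxE. Qed.

Lemma dot_sumr (I : Type) (r : seq I) (P : pred I) u (F : I -> 'cV[R]_p) :
  dot u (\sum_(i <- r | P i) F i) = \sum_(i <- r | P i) dot u (F i).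
Proof. by rewrite /dot mulmx_sumr summxE. Qed.

Lemma dot_mulmx A u v : dot u (A *m v) = dot (A^T *m u) v.
Proof. by rewrite /dot trmx_mul trmxK mulmxA. Qed.

Lemma dot_sym A u v : A^T = A -> dot u (A *m v) = dot v (A *m u).
Proof. by move=> sA; rewrite dot_mulmx sA dotC. Qed.

Lemma dot_ge0 u : 0 <= dot u u.
Proof. by rewrite dotE sumr_ge0 // => i _; rewrite -expr2 sqr_ge0. Qed.

Lemma enormE u : enorm u = Num.sqrt (dot u u).
Proof. by rewrite /enorm dotE; congr Num.sqrt; apply: eq_bigr => i _; rewrite expr2. Qed.

Lemma sqr_enorm u : enorm u ^+ 2 = dot u u.
Proof. by rewrite enormE sqr_sqrtr // dot_ge0. Qed.

Lemma enorm_ge0 u : 0 <= enorm u.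
Proof. by rewrite enormE sqrtr_ge0. Qed.

Lemma dot_eq0 u : (dot u u == 0) = (u == 0).
Proof.
apply/idP/eqP => [|->]; last by rewrite dot0r.
rewrite dotE psumr_eq0 => [/allP h|i _]; last by rewrite -expr2 sqr_ge0.
apply/matrixP => i j; rewrite ord1 mxE; apply/eqP.
by have := h i (mem_index_enum i); rewrite /= -expr2 sqrf_eq0.
Qed.

Lemma enorm_eq0 u : (enorm u == 0) = (u == 0).
Proof. by rewrite -dot_eq0 -sqr_enorm sqrf_eq0. Qed.

Lemma enormZ a u : enorm (a *: u) = `|a| * enorm u.
Proof.
by rewrite !enormE dotZl dotZr mulrA -expr2 sqrtrM ?sqr_ge0 // sqrtr_sqr.
Qed.

Lemma enormN u : enorm (- u) = enorm u.
Proof. by rewrite -scaleN1r enormZ normrN1 mul1r. Qed.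

Lemma sqr_dot_le u v : dot u v ^+ 2 <= dot u u * dot v v.
Proof.
have [/eqP|v0] := eqVneq (dot v v) 0.
  by rewrite dot_eq0 => /eqP ->; rewrite !dot0r expr0n mulr0.
have vp : 0 < dot v v by rewrite lt_neqAle eq_sym v0 dot_ge0.
(* This vector is [dot v v] times the component of [u] orthogonal to [v]; its squared norm is
   [dot v v] times the Cauchy-Schwarz gap. *)
have := dot_ge0 (dot v v *: u - dot u v *: v).
rewrite !(dotBl, dotBr, dotZl, dotZr) (dotC v u) => h.
rewrite -subr_ge0 -(pmulr_rge0 _ vp); apply: le_trans h _.
by rewrite le_eqVlt; apply/orP; left; apply/eqP; ring.
Qed.

Lemma dot_le_enorm u v : dot u v <= enorm u * enorm v.
Proof.
apply: (le_trans (ler_norm _)).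
rewrite -(@ler_pXn2r _ 2) ?nnegrE ?mulr_ge0 ?enorm_ge0 //.
by rewrite exprMn !sqr_enorm real_normK ?num_real // sqr_dot_le.
Qed.

(** For [c >= 0], an operator-norm bound in a shape that passes to sums, averages and orthogonal
    changes of basis without handling a supremum. *)
Definition form_le A (c : R) := forall u v, dot u (A *m v) <= c * (enorm u * enorm v).

Lemma form_leD A B (a b : R) : form_le A a -> form_le B b -> form_le (A + B) (a + b).
Proof. by move=> ha hb u v; rewrite mulmxDl dotDr mulrDl lerD. Qed.

Lemma form_leN A (a : R) : form_le A a -> form_le (- A) a.
Proof. by move=> ha u v; have := ha u (- v); rewrite enormN mulmxN mulNmx. Qed.

Lemma form_le0 : form_le 0 0.
Proof. by move=> u v; rewrite mul0mx dot0r mul0r. Qed.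

Lemma form_leZ A (a k : R) : 0 <= k -> form_le A a -> form_le (k *: A) (k * a).
Proof. by move=> k0 ha u v; rewrite -scalemxAl dotZr -mulrA ler_wpM2l. Qed.

Lemma form_le_sum (I : Type) (r : seq I) (F : I -> 'M[R]_p) (c : I -> R) :
  (forall i, form_le (F i) (c i)) -> form_le (\sum_(i <- r) F i) (\sum_(i <- r) c i).
Proof. by move=> h; elim/big_rec2: _ => [|i y1 y2 _]; [exact: form_le0 | exact: form_leD]. Qed.

Lemma form_le_avg (m : nat) (F : 'I_m -> 'M[R]_p) (c : R) : (0 < m)%N ->
  (forall i, form_le (F i) c) -> form_le (m%:R^-1 *: \sum_i F i) c.
Proof.
move=> m0 h; have -> : c = m%:R^-1 * \sum_(i < m) c.
  by rewrite sumr_const card_ord -[c *+ m]mulr_natl mulKf // pnatr_eq0 -lt0n.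
by apply: form_leZ; [rewrite invr_ge0 | exact: form_le_sum].
Qed.

Lemma form_le_lower A c v : form_le A c -> - c * enorm v ^+ 2 <= dot v (A *m v).
Proof. by move=> /form_leN /(_ v v); rewrite mulNmx dotNr -expr2 mulNr lerNl. Qed.

Lemma enorm_mulmx_le A c v : 0 <= c -> form_le A c -> enorm (A *m v) <= c * enorm v.
Proof.
move=> c0 h; have [->|nz] := eqVneq (enorm (A *m v)) 0; first by rewrite mulr_ge0 ?enorm_ge0.
have := h (A *m v) v; rewrite -sqr_enorm mulrCA expr2 ler_pM2l //.
by rewrite lt_neqAle eq_sym nz enorm_ge0.
Qed.

(** Cauchy-Schwarz on each row. The bound is crude, but it shows that the set defining [specnorm] is
    bounded above and the one defining [lmin] bounded below. *)
Lemma form_le_frobenius A : form_le A (Num.sqrt (\sum_i \sum_j A i j ^+ 2)).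
Proof.
move=> u v; apply: le_trans (dot_le_enorm _ _) _; rewrite mulrCA ler_wpM2l ?enorm_ge0 //.
rewrite -(@ler_pXn2r _ 2) ?nnegrE ?mulr_ge0 ?enorm_ge0 ?sqrtr_ge0 //.
rewrite exprMn !sqr_enorm sqr_sqrtr; last first.
  by apply: sumr_ge0 => i _; apply: sumr_ge0 => j _; exact: sqr_ge0.
rewrite dotE mulr_suml; apply: ler_sum => i _; rewrite -expr2.
have -> : (A *m v) i ord0 = dot (row i A)^T v.
  by rewrite dotE mxE; apply: eq_bigr => j _; rewrite !mxE.
apply: le_trans (sqr_dot_le _ _) _; rewrite ler_wpM2r ?dot_ge0 // dotE.
by apply: ler_sum => j _; rewrite !mxE expr2.
Qed.

Lemma form_le_specnorm A c : specnorm A <= c -> form_le A c.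
Proof.
rewrite /specnorm; set E := [set enorm (A *m v) | v in _].
have ubE : has_ubound E.
  exists (Num.sqrt (\sum_i \sum_j A i j ^+ 2)) => _ [v /= v1 <-].
  apply: le_trans (enorm_mulmx_le v _ (form_le_frobenius A)) _; first exact: sqrtr_ge0.
  by rewrite ler_piMr // sqrtr_ge0.
move=> Ac u v; apply: le_trans (dot_le_enorm _ _) _.
rewrite mulrCA ler_wpM2l ?enorm_ge0 //.
have [/eqP|v0] := eqVneq (enorm v) 0.
  by rewrite enorm_eq0 => /eqP ->; rewrite mulmx0 -(scale0r 0) enormZ normr0 mul0r mulr0.
have vp : 0 < enorm v by rewrite lt_neqAle eq_sym v0 enorm_ge0.
have : E (enorm (A *m ((enorm v)^-1 *: v))).
  by exists ((enorm v)^-1 *: v) => //=; rewrite enormZ ger0_norm ?invr_ge0 ?enorm_ge0 // mulVf.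
move=> /(ub_le_sup ubE) /le_trans /(_ Ac).
rewrite -scalemxAr enormZ ger0_norm ?invr_ge0 ?enorm_ge0 //.
by rewrite ler_pdivrMl // mulrC.
Qed.

End EuclideanForms.

(** * Orthogonal diagonalisation of real symmetric matrices *)

Section SpectralTheorem.
Context {R : realType}.

(* A complex eigenvalue exists; symmetry forces its imaginary part to vanish. *)
Lemma sym_eigenvector n (A : 'M[R]_n) : (0 < n)%N -> A^T = A ->
  exists a (v : 'cV[R]_n), v != 0 /\ A *m v = a *: v.
Proof.
move=> n0 sA; have symA i j : A i j = A j i by rewrite -{1}sA mxE.
pose B : 'M[R[i]]_n := map_mx (real_complex R) A.
have [c /eigenvalueP [v vB v0]] := eigenvalue_closed B n0.
pose x : 'cV[R]_n := \col_j complex.Re (v ord0 j).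
pose y : 'cV[R]_n := \col_j complex.Im (v ord0 j).
have Ax : A *m x = complex.Re c *: x - complex.Im c *: y.
  apply/colP => j; have /(congr1 (fun w : 'rV_n => complex.Re (w ord0 j))) := vB.
  rewrite !mxE raddf_sum /= => e; transitivity (complex.Re (c * v ord0 j)).
    rewrite -e; apply: eq_bigr => k _; rewrite !mxE (symA j k).
    by case: (v ord0 k) => ? ? /=; rewrite mulr0 subr0 mulrC.
  by case: (c) => ? ?; case: (v ord0 j).
have Ay : A *m y = complex.Re c *: y + complex.Im c *: x.
  apply/colP => j; have /(congr1 (fun w : 'rV_n => complex.Im (w ord0 j))) := vB.
  rewrite !mxE raddf_sum /= => e; transitivity (complex.Im (c * v ord0 j)).
    rewrite -e; apply: eq_bigr => k _; rewrite !mxE (symA j k).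
    by case: (v ord0 k) => ? ? /=; rewrite mulr0 add0r mulrC.
  by case: (c) => ? ?; case: (v ord0 j).
have xy0 : dot x x + dot y y != 0.
  rewrite paddr_eq0 ?dot_ge0 // !dot_eq0; apply: contra v0 => /andP[/eqP hx /eqP hy].
  apply/eqP/rowP => j; have /colP/(_ j) := hx; have /colP/(_ j) := hy.
  by rewrite !mxE; case: (v ord0 j) => /= ? ? -> ->.
have c0 : complex.Im c = 0.
  have := dot_sym x y sA; rewrite Ax Ay !(dotDr, dotNr, dotZr) (dotC y x) => /eqP.
  rewrite -subr_eq0 => /eqP e.
  have /eqP : complex.Im c * (dot x x + dot y y) = 0 by rewrite -e; ring.
  by rewrite mulf_eq0 (negPf xy0) orbF => /eqP.
move: Ax Ay; rewrite c0 !scale0r subr0 addr0 => Ax Ay.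
have [x0|x0] := eqVneq x 0; last by exists (complex.Re c), x.
exists (complex.Re c), y; split=> //; apply: contra_neq xy0 => y0.
by rewrite x0 y0 !dot0r addr0.
Qed.

(* The Householder reflection exchanging [v] and the first basis vector. *)
Lemma orthogonal_first_column n (v : 'cV[R]_n.+1) : dot v v = 1 ->
  exists Q : 'M[R]_n.+1, [/\ Q^T = Q, Q *m Q = 1%:M & Q *m delta_mx ord0 ord0 = v].
Proof.
move=> v1; set e : 'cV[R]_n.+1 := delta_mx ord0 ord0.
have e1 : dot e e = 1.
  rewrite dotE (bigD1 ord0) //= big1 => [|i /negPf hi]; first by rewrite addr0 !mxE eqxx mulr1.
  by rewrite !mxE hi mul0r.
have [->|ve] := eqVneq v e; first by exists 1%:M; rewrite trmx1 !mul1mx.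
pose w := v - e; have w0 : dot w w != 0 by rewrite dot_eq0 subr_eq0.
have mulw (u : 'cV[R]_n.+1) : w *m w^T *m u = dot w u *: w.
  by rewrite -mulmxA; apply/colP => i; rewrite mxE big_ord1 [RHS]mxE mulrC ord1.
pose Q : 'M[R]_n.+1 := 1%:M - (2 / dot w w) *: (w *m w^T).
exists Q; rewrite {}/Q; split.
- by rewrite linearB /= linearZ /= trmx1 trmx_mul trmxK.
- rewrite mulmxBl mul1mx mulmxBr mulmx1 -scalemxAl -scalemxAr scalerA.
  rewrite [_ *m (w *m _)]mulmxA mulw -scalemxAl scalerA.
  rewrite -addrA -opprD -scalerBl -scalerDl.
  suff -> : 2 / dot w w + (2 / dot w w - 2 / dot w w * (2 / dot w w) * dot w w) = 0.
    by rewrite scale0r subr0.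
  by field.
- rewrite mulmxBl mul1mx -scalemxAl mulw scalerA.
  have -> : 2 / dot w w * dot w e = -1.
    apply: (mulIf w0); rewrite mulrAC divfK //.
    by rewrite /w !(dotBl, dotBr) e1 v1 (dotC e v); ring.
  by rewrite scaleN1r opprK /w addrC subrK.
Qed.

(** Induction on the dimension: conjugating by a reflection that sends the first basis vector to a
    unit eigenvector clears the rest of the first column, symmetry clears the first row, and the
    lower block is diagonalised by induction. *)
Theorem sym_spectral n (A : 'M[R]_n) : A^T = A ->
  exists (V : 'M[R]_n) (d : 'rV[R]_n), V^T *m V = 1%:M /\ A = V *m diag_mx d *m V^T.
Proof.
elim: n A => [|n IHn] A sA.
  by exists 1%:M, 0; split; [rewrite trmx1 mul1mx | apply/matrixP => - []].
have [a [v0 [v0n Av0]]] := sym_eigenvector (ltn0Sn n) sA.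
pose v := (enorm v0)^-1 *: v0.
have v1 : dot v v = 1.
  rewrite dotZl dotZr -sqr_enorm expr2 mulrA -invfM mulVf //.
  by rewrite mulf_neq0 // enorm_eq0.
have Av : A *m v = a *: v by rewrite -scalemxAr Av0 scalerA mulrC -scalerA.
have [Q [sQ QQ Qe]] := orthogonal_first_column v1.
have [B BQ] : exists B : 'M[R]_(1 + n), B = Q *m A *m Q by eexists.
have sB : B^T = B by rewrite BQ !trmx_mul sQ sA mulmxA.
have Be i : B i ord0 = a *+ (i == ord0).
  have : B *m delta_mx ord0 ord0 = a *: delta_mx ord0 ord0 :> 'cV_n.+1.
    by rewrite BQ -!mulmxA Qe Av -scalemxAr -Qe !mulmxA QQ mul1mx.
  by move/colP/(_ i); rewrite -colE !mxE eqxx andbT mulr_natr.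
have l0 : lshift n ord0 = ord0 :> 'I_(1 + n) by exact: val_inj.
have BE : B = block_mx a%:M 0 0 (drsubmx B).
  rewrite -[LHS]submxK; congr block_mx.
  - apply/matrixP => i j; rewrite !mxE !ord1 /=.
    by rewrite l0 Be.
  - apply/matrixP => i j; rewrite !mxE !ord1 /=.
    rewrite -sB [LHS]mxE.
    by rewrite l0 Be.
  - apply/matrixP => i j; rewrite !mxE !ord1 /=.
    by rewrite l0 Be.
have sB' : (drsubmx B)^T = drsubmx B by rewrite trmx_drsub sB.
have [V [d [VV BV]]] := IHn _ sB'.
have [W [WW WB]] : exists W : 'M[R]_(1 + n), W^T *m W = 1%:M /\
    W *m diag_mx (row_mx a%:M d) *m W^T = B.
  exists (block_mx 1%:M 0 0 V); rewrite tr_block_mx !trmx0 trmx1; split.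
    by rewrite mulmx_block !mulmx0 !mul0mx VV !mulmx1 !addr0 !add0r -scalar_mx_block.
  rewrite diag_mx_row !mulmx_block !mulmx0 !mul0mx !addr0 !add0r !mulmx1 !mul1mx -BV.
  rewrite [RHS]BE; congr block_mx; rewrite ?mul0mx //.
  by apply/matrixP => i j; rewrite !mxE !ord1 eqxx.
exists (Q *m W), (row_mx a%:M d); split.
  by rewrite trmx_mul sQ mulmxA -(mulmxA _ Q Q) QQ mulmx1.
have -> : A = Q *m B *m Q by rewrite BQ !mulmxA QQ mul1mx -mulmxA QQ mulmx1.
by rewrite trmx_mul sQ -WB !mulmxA.
Qed.

End SpectralTheorem.

(** * Eigenvalues, quadratic forms and spectral regularization *)

Section Eigenvalues.
Context {R : realType} {p : nat}.
Implicit Types (A H M V : 'M[R]_p) (d : 'rV[R]_p) (u v : 'cV[R]_p).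

Lemma diag_mulE d v i : (diag_mx d *m v) i ord0 = d ord0 i * v i ord0.
Proof. by rewrite mul_diag_mx mxE. Qed.

Lemma sym_diag_form V d : (V *m diag_mx d *m V^T)^T = V *m diag_mx d *m V^T.
Proof. by rewrite !trmx_mul trmxK tr_diag_mx mulmxA. Qed.

Lemma dot_orthogonal V u : V^T *m V = 1%:M -> dot (V^T *m u) (V^T *m u) = dot u u.
Proof. by move=> VV; rewrite dot_mulmx trmxK mulmxA (mulmx1C VV) mul1mx. Qed.

Lemma dot_diag V d u v :
  dot u (V *m diag_mx d *m V^T *m v) =
  \sum_i d ord0 i * ((V^T *m u) i ord0 * (V^T *m v) i ord0).
Proof.
rewrite -!mulmxA dot_mulmx dotE; apply: eq_bigr => i _.
by rewrite diag_mulE mulrCA.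
Qed.

Lemma dot_diag_ge V d c : V^T *m V = 1%:M -> (forall i, c <= d ord0 i) ->
  forall v, c * enorm v ^+ 2 <= dot v (V *m diag_mx d *m V^T *m v).
Proof.
move=> VV cd v; rewrite sqr_enorm -(dot_orthogonal v VV) dot_diag dotE mulr_sumr.
by apply: ler_sum => i _; rewrite ler_wpM2r // -expr2 sqr_ge0.
Qed.

Lemma dot_diag_col V d i : V^T *m V = 1%:M ->
  let v := V *m delta_mx i ord0 in
  dot v v = 1 /\ (V *m diag_mx d *m V^T *m v) = d ord0 i *: v.
Proof.
move=> VV v; have Vv : V^T *m v = delta_mx i ord0 by rewrite mulmxA VV mul1mx.
split.
  rewrite -(dot_orthogonal v VV) Vv dotE (bigD1 i) //= big1 => [|j /negPf ji].
    by rewrite addr0 !mxE !eqxx mulr1.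
  by rewrite !mxE ji mul0r.
rewrite -!mulmxA Vv /v scalemxAr; congr (V *m _); apply/colP => j.
by rewrite diag_mulE !mxE; case: eqVneq => [->|]; rewrite ?mulr0.
Qed.

Lemma form_le_diag V d c : 0 <= c -> V^T *m V = 1%:M -> (forall i, `|d ord0 i| <= c) ->
  form_le (V *m diag_mx d *m V^T) c.
Proof.
move=> c0 VV dc u v; rewrite -!mulmxA dot_mulmx; apply: le_trans (dot_le_enorm _ _) _.
rewrite mulrCA !enormE (dot_orthogonal u VV) ler_wpM2l ?sqrtr_ge0 //.
rewrite -(dot_orthogonal v VV) -[c]ger0_norm // -sqrtr_sqr -sqrtrM ?sqr_ge0 //.
rewrite ler_wsqrtr // !dotE mulr_sumr; apply: ler_sum => i _.
rewrite diag_mulE mulrACA -!expr2 ler_wpM2r ?sqr_ge0 //.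
by rewrite -(real_normK (num_real (d _ _))) ler_pXn2r ?nnegrE.
Qed.

Lemma eigenvalue_form_ge A a c : A^T = A ->
  (forall v, c * enorm v ^+ 2 <= dot v (A *m v)) -> eigenvalue A a -> c <= a.
Proof.
move=> sA cA /eigenvalueP [v vA v0]; have := cA v^T.
have -> : A *m v^T = a *: v^T by rewrite -{1}sA -trmx_mul vA linearZ.
rewrite dotZr -sqr_enorm ler_pM2r // exprn_gt0 // lt_neqAle enorm_ge0 andbT eq_sym.
by rewrite enorm_eq0; apply: contra v0 => /eqP /(congr1 trmx); rewrite trmxK trmx0 => ->.
Qed.

Lemma eigenvalue_diag V d i : V^T *m V = 1%:M ->
  eigenvalue (V *m diag_mx d *m V^T) (d ord0 i).
Proof.
move=> VV; have /= [v1 vE] := dot_diag_col d i VV.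
apply/eigenvalueP; exists (V *m delta_mx i ord0)^T.
  by rewrite -[X in _ *m X]sym_diag_form -trmx_mul vE linearZ.
apply/eqP => /(congr1 trmx); rewrite trmxK trmx0 => e0.
by move: v1; rewrite e0 dot0r => /eqP; rewrite eq_sym oner_eq0.
Qed.

(** Each diagonal entry of an eigen-decomposition is an eigenvalue, hence at least the infimum, the
    spectrum being bounded below by minus the Frobenius norm. *)
Lemma lmin_le_form A : A^T = A -> forall v, lmin A * enorm v ^+ 2 <= dot v (A *m v).
Proof.
move=> sA; have [V [d [VV AE]]] := sym_spectral sA.
rewrite {2}AE; apply: dot_diag_ge => // i; apply: ge_inf; last first.
  by rewrite /= AE; exact: eigenvalue_diag.
exists (- Num.sqrt (\sum_i \sum_j A i j ^+ 2)) => a /=.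
apply: eigenvalue_form_ge => // v; apply: form_le_lower; exact: form_le_frobenius.
Qed.

(** Positive dimension makes the spectrum nonempty; on an empty set [inf] would be a default
    value. *)
Lemma form_le_lmin A c : (0 < p)%N -> A^T = A ->
  (forall v, c * enorm v ^+ 2 <= dot v (A *m v)) -> c <= lmin A.
Proof.
move=> p0 sA cA; apply: lb_le_inf => [|a /=]; last exact: eigenvalue_form_ge.
have [V [d [VV ->]]] := sym_spectral sA.
by exists (d ord0 (Ordinal p0)); exact: eigenvalue_diag.
Qed.

Lemma spec_reg_ge lam H M : spec_reg lam H M ->
  forall v, lam * enorm v ^+ 2 <= dot v (M *m v).
Proof.
move=> [V [d [VV [_ ->]]]]; apply: dot_diag_ge => // i.
by rewrite mxE le_max lexx orbT.
Qed.

Lemma spec_reg_sym lam H M : spec_reg lam H M -> M^T = M.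
Proof. by move=> [V [d [VV [_ ->]]]]; exact: sym_diag_form. Qed.

(** In the eigenbasis of [H] the difference has diagonal entries [max(d_i, lam) - d_i]: zero above
    the threshold, at most [lam - mu] below it. *)
Lemma spec_reg_sub lam mu H M : spec_reg lam H M ->
  (forall v, mu * enorm v ^+ 2 <= dot v (H *m v)) ->
  form_le (M - H) (Num.max (lam - mu) 0).
Proof.
move=> [V [d [VV [HE ->]]]] muH.
have mud i : mu <= d ord0 i.
  apply: (@eigenvalue_form_ge H) => //; rewrite HE; [exact: sym_diag_form | exact: eigenvalue_diag].
rewrite HE -mulmxBl -mulmxBr -linearB /=; apply: form_le_diag => // [|i].
  by rewrite le_max lexx orbT.
rewrite !mxE ger0_norm ?subr_ge0 ?le_max ?lexx //.
have [dl|ld] := leP (d ord0 i) lam; last by rewrite subrr lexx orbT.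
by rewrite lerD2l lerN2 mud.
Qed.

End Eigenvalues.

(** * Trace inequalities for powers of symmetric matrices *)

Section TraceInequalities.
Context {R : realType} {p : nat}.
Implicit Types (A D Y Z V W : 'M[R]_p) (a b d : 'rV[R]_p).

(** The gap factors as [(x^i - y^i)(x^j - y^j)], and monotonicity of powers gives both factors the
    same sign. *)
Lemma expr_mul_le (x y : R) i j : 0 <= x -> 0 <= y ->
  x ^+ i * y ^+ j + x ^+ j * y ^+ i <= x ^+ (i + j) + y ^+ (i + j).
Proof.
move=> x0 y0; rewrite -subr_ge0.
have -> : x ^+ (i + j) + y ^+ (i + j) - (x ^+ i * y ^+ j + x ^+ j * y ^+ i) =
  (x ^+ i - y ^+ i) * (x ^+ j - y ^+ j) by rewrite !exprD; ring.
have [xy|/ltW yx] := leP x y.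
  by rewrite mulr_le0 // subr_le0 lerXn2r.
by rewrite mulr_ge0 // subr_ge0 lerXn2r.
Qed.

Lemma even_expr_norm (x : R) q : `|x| ^+ (2 * q) = x ^+ (2 * q).
Proof. by rewrite !exprM real_normK ?num_real. Qed.

(** Scalar model of the trace inequality. After factoring, the geometric sum is added to its
    reversal and each pair of mirrored terms is bounded by [expr_mul_le]; the resulting exponent
    [2 * q] is even, so absolute values disappear. *)
Lemma sub_mul_subX_le (x y : R) q : (x - y) * (x ^+ (2 * q).+1 - y ^+ (2 * q).+1) <=
  (2 * q).+1%:R / 2 * ((x - y) ^+ 2 * (x ^+ (2 * q) + y ^+ (2 * q))).
Proof.
rewrite subrXX mulrA -expr2 mulrCA ler_wpM2l ?sqr_ge0 //=.
set s := \sum_(i < _) _.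
have sE : s = \sum_(i < (2 * q).+1) x ^+ i * y ^+ (2 * q - i).
  rewrite /s (reindex_inj rev_ord_inj) /=; apply: eq_bigr => i _.
  by rewrite subSS subKn // -ltnS.
rewrite mulrAC ler_pdivlMr // mulr_natr mulr2n {2}sE -big_split /=.
rewrite mulr_natl -[leRHS]addr0 -[X in _ *+ X]card_ord -sumr_const addr0.
apply: ler_sum => i _; have iq : (i <= 2 * q)%N by rewrite -ltnS.
apply: le_trans (ler_norm _) _; apply: le_trans (ler_normD _ _) _.
rewrite !normrM !normrX; apply: le_trans (expr_mul_le _ _ _ _) _ => //.
by rewrite subnK // !even_expr_norm.
Qed.

Lemma expr_diag_form V d k : V^T *m V = 1%:M ->
  (V *m diag_mx d *m V^T) ^+ k = V *m diag_mx (\row_i d ord0 i ^+ k) *m V^T.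
Proof.
move=> VV; elim: k => [|k IH].
  rewrite expr0 (_ : diag_mx _ = 1%:M) ?mulmx1 ?(mulmx1C VV) //.
  by apply/matrixP => i j; rewrite !mxE expr0.
rewrite exprS IH -mulmxE !mulmxA -(mulmxA _ V^T V) VV mulmx1 -(mulmxA V) mulmx_diag.
by congr (_ *m diag_mx _ *m _); apply/rowP => i; rewrite !mxE exprS.
Qed.

(** The weights are squared overlaps of the two bases, hence nonnegative: a scalar inequality valid
    at all pairs of eigenvalues passes to traces even when the matrices do not commute. *)
Lemma mxtrace_diag_formM V W a b :
  \tr ((V *m diag_mx a *m V^T) *m (W *m diag_mx b *m W^T)) =
  \sum_i \sum_j a ord0 i * b ord0 j * (V^T *m W) i j ^+ 2.
Proof.
have -> : \tr ((V *m diag_mx a *m V^T) *m (W *m diag_mx b *m W^T)) =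
    \tr ((diag_mx a *m (V^T *m W)) *m (diag_mx b *m (V^T *m W)^T)).
  by rewrite -!mulmxA mxtrace_mulC trmx_mul trmxK -!mulmxA.
rewrite /mxtrace; apply: eq_bigr => i _; rewrite mxE; apply: eq_bigr => j _.
set C := V^T *m W; rewrite !mul_diag_mx [X in X * _]mxE [X in _ * X]mxE [C^T _ _]mxE.
by rewrite expr2; ring.
Qed.

Lemma mxtrace_expr V d k : V^T *m V = 1%:M ->
  \tr ((V *m diag_mx d *m V^T) ^+ k) = \sum_i d ord0 i ^+ k.
Proof.
move=> VV; rewrite expr_diag_form // -mulmxA mxtrace_mulC -mulmxA VV mulmx1 mxtrace_diag.
by apply: eq_bigr => i _; rewrite mxE.
Qed.

Lemma mxtrace_expr_sub_le Y Z q : Y^T = Y -> Z^T = Z ->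
  \tr ((Y - Z) *m (Y ^+ (2 * q).+1 - Z ^+ (2 * q).+1)) <=
  (2 * q).+1%:R / 2 * \tr ((Y - Z) *m (Y - Z) *m (Y ^+ (2 * q) + Z ^+ (2 * q))).
Proof.
move=> sY sZ; have [V [a [VV YE]]] := sym_spectral sY.
have [W [b [WW ZE]]] := sym_spectral sZ.
have F k l : \tr (Y ^+ k *m Z ^+ l) =
    \sum_i \sum_j a ord0 i ^+ k * b ord0 j ^+ l * (V^T *m W) i j ^+ 2.
  rewrite YE ZE !expr_diag_form // mxtrace_diag_formM.
  by apply: eq_bigr => i _; apply: eq_bigr => j _; rewrite !mxE.
set N := (2 * q).+1.
have trN (X : 'M[R]_p) : \tr (- X) = - \tr X by rewrite raddfN.
(* Here and in [l2], cyclicity reduces every word to some [tr (Y^k Z^l)]; zeroth powers are kept so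
   that [F] applies to all of them alike. *)
have l1 : \tr ((Y - Z) *m (Y ^+ N - Z ^+ N)) = \tr (Y ^+ N.+1 *m Z ^+ 0)
    - \tr (Y ^+ 1 *m Z ^+ N) - \tr (Y ^+ N *m Z ^+ 1) + \tr (Y ^+ 0 *m Z ^+ N.+1).
  rewrite !expr0 !expr1 mulmx1 mul1mx mulmxBl !mulmxBr !raddfB /= (mxtrace_mulC Z (Y ^+ N)).
  by rewrite !mulmxE -!exprS; ring.
have l2 : \tr ((Y - Z) *m (Y - Z) *m (Y ^+ (2 * q) + Z ^+ (2 * q))) =
    \tr (Y ^+ N.+1 *m Z ^+ 0) - \tr (Y ^+ N *m Z ^+ 1) *+ 2 + \tr (Y ^+ (2 * q) *m Z ^+ 2)
    + (\tr (Y ^+ 2 *m Z ^+ (2 * q)) - \tr (Y ^+ 1 *m Z ^+ N) *+ 2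
       + \tr (Y ^+ 0 *m Z ^+ N.+1)).
  have e1 : \tr (Y *m Z *m Y ^+ (2 * q)) = \tr (Y ^+ N *m Z ^+ 1).
    by rewrite mxtrace_mulC mulmxA mulmxE -exprSr expr1.
  have e2 : \tr (Z *m Y *m Y ^+ (2 * q)) = \tr (Y ^+ N *m Z ^+ 1).
    by rewrite -mulmxA mxtrace_mulC mulmxE -exprS expr1.
  have e3 : \tr (Z *m Z *m Y ^+ (2 * q)) = \tr (Y ^+ (2 * q) *m Z ^+ 2).
    by rewrite mxtrace_mulC.
  have e4 : \tr (Z *m Y *m Z ^+ (2 * q)) = \tr (Y ^+ 1 *m Z ^+ N).
    by rewrite mxtrace_mulC mulmxA mulmxE -exprSr expr1 mxtrace_mulC.
  have e5 : \tr (Y *m Z *m Z ^+ (2 * q)) = \tr (Y ^+ 1 *m Z ^+ N).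
    by rewrite -mulmxA mulmxE -exprS expr1.
  have e6 : \tr (Y *m Y *m Y ^+ (2 * q)) = \tr (Y ^+ N.+1 *m Z ^+ 0).
    by rewrite expr0 mulmx1 -mulmxA !mulmxE -!exprS.
  have e7 : \tr (Z *m Z *m Z ^+ (2 * q)) = \tr (Y ^+ 0 *m Z ^+ N.+1).
    by rewrite expr0 mul1mx -mulmxA !mulmxE -!exprS.
  rewrite !(mulmxBl, mulmxBr, mulmxDr, mulmxDl) !(mulNmx, opprD, opprK, mxtraceD, trN).
  rewrite e1 e2 e3 e4 e5 e6 e7 [\tr (Y *m Y *m _)](_ : _ = \tr (Y ^+ 2 *m Z ^+ (2 * q))) //.
  move: (\tr (Y ^+ N.+1 *m Z ^+ 0)) (\tr (Y ^+ N *m Z ^+ 1)) (\tr (Y ^+ (2 * q) *m Z ^+ 2))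
    (\tr (Y ^+ 2 *m Z ^+ (2 * q))) (\tr (Y ^+ 1 *m Z ^+ N)) (\tr (Y ^+ 0 *m Z ^+ N.+1)).
  by move=> *; ring.
rewrite l1 l2 !F -!sumrMnl -!sumrN -!big_split /= mulr_sumr; apply: ler_sum => i _.
rewrite -!sumrMnl -!sumrN -!big_split /= mulr_sumr; apply: ler_sum => j _.
have := ler_wpM2r (sqr_ge0 ((V^T *m W) i j)) (sub_mul_subX_le (a ord0 i) (b ord0 j) q).
rewrite -/N /N !exprS !expr0 !mulr1 => h; apply: le_trans (le_trans _ h) _; rewrite le_eqVlt.
  by apply/orP; left; apply/eqP; ring.
by apply/orP; left; apply/eqP; ring.
Qed.

Lemma mxtrace_expr_ge0 Y q : Y^T = Y -> 0 <= \tr (Y ^+ (2 * q)).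
Proof.
move=> sY; have [V [a [VV ->]]] := sym_spectral sY; rewrite mxtrace_expr //.
by apply: sumr_ge0 => i _; rewrite -even_expr_norm exprn_ge0.
Qed.

Lemma dot_delta A i j : dot (delta_mx i ord0) (A *m delta_mx j ord0) = A i j.
Proof. by rewrite /dot trmx_delta mulmxA -rowE -colE !mxE. Qed.

(** In an eigenbasis [v_i] of [Y] the trace is the sum of [a_i^(2q) |D v_i|^2], with
    [|D v_i| <= c]. *)
Lemma mxtrace_sqrM_expr_le D Y c q : 0 <= c -> D^T = D -> Y^T = Y -> form_le D c ->
  \tr (D *m D *m Y ^+ (2 * q)) <= c ^+ 2 * \tr (Y ^+ (2 * q)).
Proof.
move=> c0 sD sY Dc; have [V [a [VV ->]]] := sym_spectral sY; rewrite mxtrace_expr //.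
rewrite expr_diag_form // !mulmxA mxtrace_mulC !mulmxA mulr_sumr.
apply: ler_sum => i _; rewrite mul_mx_diag mxE [X in _ * X]mxE.
apply: ler_wpM2r; first by rewrite -even_expr_norm exprn_ge0.
have /= [v1 _] := dot_diag_col a i VV; set v := V *m delta_mx i ord0 in v1 *.
have -> : (V^T *m D *m D *m V) i i = dot (D *m v) (D *m v).
  by rewrite -dot_delta -!mulmxA dot_mulmx trmxK dot_mulmx sD.
rewrite -sqr_enorm; apply: le_trans (lerXn2r 2 _ _ (enorm_mulmx_le v c0 Dc)) _.
- by rewrite nnegrE enorm_ge0.
- by rewrite nnegrE mulr_ge0 ?enorm_ge0.
by rewrite exprMn sqr_enorm v1 mulr1.
Qed.

End TraceInequalities.

(** * Moment method for uniform samples of symmetric matrices *)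

Section MatrixSampling.
Context {R : realType} {p n m : nat}.
Variables (A : 'I_n -> 'M[R]_p) (G : 'M[R]_p) (K : R).
Hypotheses (n0 : (0 < n)%N) (m0 : (0 < m)%N) (K0 : 0 < K).
Hypotheses (symA : forall i, (A i)^T = A i) (AK : forall i, form_le (A i) K).
Hypothesis GE : n%:R *: G = \sum_i A i.
Implicit Types (S : m.-tuple 'I_n) (t : 'I_m) (j : 'I_n).

Let T := m.-tuple 'I_n.

Definition sample_dev S : 'M[R]_p := \sum_(t < m) (A (tnth S t) - G).

Let symG : G^T = G.
Proof.
have nR : n%:R != 0 :> R by rewrite pnatr_eq0 -lt0n.
rewrite -(scalerK nR G) GE linearZ linear_sum /=; congr (_ *: _).
by apply: eq_bigr => i _; rewrite symA.
Qed.

Let sym_dev S : (sample_dev S)^T = sample_dev S.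
Proof. by rewrite linear_sum; apply: eq_bigr => t _; rewrite linearB /= symA symG. Qed.

Definition resample S t j : T := mktuple (fun u => if u == t then j else tnth S u).

Lemma resample_dev S t j : sample_dev S - sample_dev (resample S t j) = A (tnth S t) - A j.
Proof.
rewrite /sample_dev (bigD1 t) //= [X in _ - X](bigD1 t) //= tnth_mktuple eqxx.
under [X in _ - (_ + X)]eq_bigr => u /negPf ut do rewrite tnth_mktuple ut.
by rewrite opprD addrACA subrr addr0 opprB addrA subrK.
Qed.

Lemma resampleK S t j : resample (resample S t j) t (tnth S t) = S.
Proof.
apply: eq_from_tnth => u; rewrite !tnth_mktuple.
by case: eqVneq => [->|]//.
Qed.

(** Exchangeability: swapping the [t]-th entry of the sample with the fresh draw [j] is an
    involution on pairs, so it permutes the terms of the double sum. *)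
Lemma resample_swap t (F : T -> 'I_n -> R) :
  \sum_S \sum_j F S j = \sum_S \sum_j F (resample S t j) (tnth S t).
Proof.
rewrite !pair_big /=; pose h (x : T * 'I_n) := (resample x.1 t x.2, tnth x.1 t).
have hK : involutive h.
  by move=> [S j]; rewrite /h /= resampleK tnth_mktuple eqxx.
by rewrite (reindex_inj (inv_inj hK)).
Qed.

(** An expectation left unnormalised, that is, multiplied by the number of samples. *)
Let moment q : R := \sum_S \tr (sample_dev S ^+ (2 * q)).

Lemma moment_coord_le t q :
  \sum_S \tr ((A (tnth S t) - G) *m sample_dev S ^+ (2 * q).+1) <=
  2 * (2 * q).+1%:R * K ^+ 2 * moment q.
Proof.
set N := (2 * q).+1; pose Psi S j := \tr ((A (tnth S t) - A j) *m sample_dev S ^+ N).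
have nR : 0 < n%:R :> R by rewrite ltr0n.
(* The mean [G] is replaced by a fresh draw [A j], summed over [j]. *)
have avg : n%:R * \sum_S \tr ((A (tnth S t) - G) *m sample_dev S ^+ N) =
    \sum_S \sum_j Psi S j.
  rewrite mulr_sumr; apply: eq_bigr => S _; rewrite -linear_sum /= -mulmx_suml sumrB.
  by rewrite sumr_const card_ord -GE -[A _ *+ n]scaler_nat -scalerBr -scalemxAl mxtraceZ.
(* Adding the swapped copy symmetrises: the swap reverses the difference of the two matrices and
   moves the power to the resampled deviation. *)
have dbl : (\sum_S \sum_j Psi S j) *+ 2 = \sum_S \sum_j
    \tr ((sample_dev S - sample_dev (resample S t j)) *m
         (sample_dev S ^+ N - sample_dev (resample S t j) ^+ N)).
  rewrite mulr2n {2}(resample_swap t) -big_split; apply: eq_bigr => S _ /=.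
  rewrite -big_split; apply: eq_bigr => j _; rewrite /Psi /= tnth_mktuple eqxx resample_dev.
  by rewrite mulmxBr raddfB /= -[A j - _]opprB mulNmx; rewrite raddfN.
(* One resampling moves the deviation by at most [2K], so [N/2 * (2K)^2] becomes [2 N K^2]. *)
have step S j : \tr ((sample_dev S - sample_dev (resample S t j)) *m
         (sample_dev S ^+ N - sample_dev (resample S t j) ^+ N)) <=
    N%:R * 2 * K ^+ 2 * (\tr (sample_dev S ^+ (2 * q)) +
                         \tr (sample_dev (resample S t j) ^+ (2 * q))).
  apply: le_trans (mxtrace_expr_sub_le _ (sym_dev _) (sym_dev _)) _.
  have DK : form_le (sample_dev S - sample_dev (resample S t j)) (K + K).
    by rewrite resample_dev; apply: form_leD => //; exact: form_leN.
  have sD : (sample_dev S - sample_dev (resample S t j))^T =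
      sample_dev S - sample_dev (resample S t j) by rewrite linearB /= !sym_dev.
  have KK : 0 <= K + K by rewrite addr_ge0 ?ltW.
  rewrite mulmxDr mxtraceD.
  have h1 := mxtrace_sqrM_expr_le q KK sD (sym_dev S) DK.
  have h2 := mxtrace_sqrM_expr_le q KK sD (sym_dev (resample S t j)) DK.
  have N0 : 0 <= N%:R / 2 :> R by rewrite divr_ge0.
  apply: le_trans (ler_wpM2l N0 (lerD h1 h2)) _.
  by rewrite le_eqVlt; apply/orP; left; apply/eqP; field.
have tot : \sum_S \sum_j (\tr (sample_dev S ^+ (2 * q)) +
    \tr (sample_dev (resample S t j) ^+ (2 * q))) = n%:R * (moment q *+ 2).
  have e : \sum_S \sum_(j < n) \tr (sample_dev S ^+ (2 * q)) = n%:R * moment q.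
    by rewrite /moment mulr_sumr; apply: eq_bigr => S _; rewrite sumr_const card_ord mulr_natl.
  rewrite (eq_bigr (fun S => \sum_(j < n) \tr (sample_dev S ^+ (2 * q)) +
    \sum_j \tr (sample_dev (resample S t j) ^+ (2 * q)))); last first.
    by move=> S _; rewrite big_split.
  rewrite big_split /= -(resample_swap t (fun S _ => \tr (sample_dev S ^+ (2 * q)))) e.
  by rewrite -mulr2n mulrnAr.
rewrite -(ler_pM2l nR) avg -(ler_pMn2r (isT : (0 < 2)%N)) dbl.
apply: le_trans (ler_sum _ (fun S _ => ler_sum _ (fun j _ => step S j))) _.
under eq_bigr do rewrite -mulr_sumr.
rewrite -mulr_sumr tot le_eqVlt; apply/orP; left; apply/eqP.
by rewrite mulr2n; ring.
Qed.

(** One factor of the power is expanded over the [m] coordinates. The constant is split so that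
    [(2q+1)/2] can be compared with [q+1] on iteration. *)
Lemma moment_rec q : moment q.+1 <= (4 * m%:R * K ^+ 2) * ((2 * q).+1%:R / 2) * moment q.
Proof.
have -> : moment q.+1 =
    \sum_t \sum_S \tr ((A (tnth S t) - G) *m sample_dev S ^+ (2 * q).+1).
  rewrite exchange_big; apply: eq_bigr => S _.
  rewrite mulnS -linear_sum /= -mulmx_suml -[\sum_(i < m) (A _ - G)]/(sample_dev S).
  by rewrite mulmxE -exprS.
apply: le_trans (ler_sum _ (fun t _ => moment_coord_le t q)) _.
rewrite sumr_const card_ord -mulr_natl le_eqVlt; apply/orP; left; apply/eqP.
by field.
Qed.

(** The factors [(2q+1)/2] are bounded by [q+1] and multiply to a factorial, except the first, which
    is exactly [1/2] and becomes the final division by 2. *)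
Lemma moment_le q : moment q.+1 <=
  (4 * m%:R * K ^+ 2) ^+ q.+1 * q.+1`!%:R * (p%:R * #|{: T}|%:R / 2).
Proof.
have b0 : 0 <= 4 * m%:R * K ^+ 2 by rewrite mulr_ge0 ?sqr_ge0 // mulr_ge0.
elim: q => [|q IH]; apply: le_trans (moment_rec _) _.
  rewrite /moment (eq_bigr (fun=> p%:R)) => [|S _]; last by rewrite muln0 expr0 mxtrace1.
  rewrite sumr_const muln0 expr1 !mulr1 -[p%:R *+ _]mulr_natr.
  by rewrite le_eqVlt; apply/orP; left; apply/eqP; field.
apply: le_trans (ler_wpM2l _ IH) _; first by rewrite mulr_ge0 // divr_ge0.
have -> : (4 * m%:R * K ^+ 2) ^+ q.+2 * q.+2`!%:R * (p%:R * #|{: T}|%:R / 2) =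
   (4 * m%:R * K ^+ 2) * q.+2%:R *
   ((4 * m%:R * K ^+ 2) ^+ q.+1 * q.+1`!%:R * (p%:R * #|{: T}|%:R / 2)).
  by rewrite (factS q.+1) natrM exprS; ring.
apply: ler_wpM2r; first by rewrite !mulr_ge0 ?exprn_ge0 ?invr_ge0.
apply: ler_wpM2l => //; rewrite ler_pdivrMr // -natrM ler_nat.
by rewrite [leqRHS]mulnC [leqRHS]mulnS ltnS leqnSn.
Qed.

Variable t0 : R.
Hypothesis t0_gt0 : 0 < t0.

Definition sample_good : {pred T} :=
  fun S => `[< form_le (m%:R^-1 *: \sum_(t < m) A (tnth S t) - G) t0 >].

(** A bad sample has a deviation with some eigenvalue above [m t0] in absolute value, and the trace
    of an even power dominates the contribution of that eigenvalue. *)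
Lemma bad_sample_mxtrace S q : S \notin sample_good ->
  (m%:R * t0) ^+ (2 * q) <= \tr (sample_dev S ^+ (2 * q)).
Proof.
have mR : 0 < m%:R :> R by rewrite ltr0n.
have mt : 0 <= m%:R * t0 by rewrite mulr_ge0 // ltW.
move=> bad; have [V [a [VV ZE]]] := sym_spectral (sym_dev S).
have [i ai] : exists i, m%:R * t0 < `|a ord0 i|.
  apply: contrapT => /forallNP small; move: bad; apply/negP; rewrite negbK.
  apply/asboolP; suff h : form_le (sample_dev S) (m%:R * t0).
    have -> : m%:R^-1 *: \sum_(t < m) A (tnth S t) - G = m%:R^-1 *: sample_dev S.
      rewrite /sample_dev sumrB sumr_const card_ord -[G *+ m]scaler_nat scalerBr scalerA.
      by rewrite mulVf ?gt_eqF // scale1r.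
    have -> : t0 = m%:R^-1 * (m%:R * t0) by rewrite mulKf ?gt_eqF.
    by apply: form_leZ => //; rewrite invr_ge0 ltW.
  by rewrite ZE; apply: form_le_diag => // i; rewrite leNgt; apply/negP/small.
rewrite ZE mxtrace_expr // (bigD1 i) //= -[leLHS]addr0 lerD //.
  by rewrite -(even_expr_norm (a _ _)) lerXn2r ?nnegrE ?normr_ge0 // ltW.
by apply: sumr_ge0 => j _; rewrite -even_expr_norm exprn_ge0.
Qed.

(** Markov's inequality in counting form. *)
Lemma card_bad_expr_le q :
  #|[predC sample_good]|%:R * (m%:R * t0) ^+ (2 * q) <= moment q.
Proof.
rewrite /moment (bigID [predC sample_good]) /= -[leLHS]addr0 lerD //; last first.
  by apply: sumr_ge0 => S _; apply: mxtrace_expr_ge0.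
rewrite mulr_natl -sumr_const; apply: ler_sum => S bad; exact: bad_sample_mxtrace.
Qed.

(** This is [2/3] times [(m t0)^2 / (4 m K^2)]: the constant 6 turns the moment bounds, divided by
    factorials, into a geometric sequence of ratio [2/3]. *)
Let z := m%:R * t0 ^+ 2 / (6 * K ^+ 2).

(** The indicator accounts for [q = 0], where the moment is the full [p #|T|], without the factor
    [1/2] of the higher ones. *)
Lemma card_bad_coeff_le q : #|[predC sample_good]|%:R * (z ^+ q / q`!%:R) <=
  p%:R * #|{: T}|%:R / 2 * ((q == 0)%N%:R + (2 / 3) ^+ q).
Proof.
have mR : 0 < m%:R :> R by rewrite ltr0n.
case: q => [|q].
  have := card_bad_expr_le 0; rewrite muln0 !expr0 divr1 => /le_trans; apply.
  rewrite /moment (eq_bigr (fun=> p%:R)) => [|S _]; last by rewrite muln0 expr0 mxtrace1.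
  rewrite sumr_const -[p%:R *+ _]mulr_natr eqxx /= mulr1n.
  by rewrite le_eqVlt; apply/orP; left; apply/eqP; field.
rewrite /= add0r; have h := le_trans (card_bad_expr_le q.+1) (moment_le q).
have b0 : 0 < 4 * m%:R * K ^+ 2 by rewrite mulr_gt0 ?exprn_gt0 // mulr_gt0.
have f0 : 0 < q.+1`!%:R :> R by rewrite ltr0n fact_gt0.
have zE : z ^+ q.+1 = (2 / 3) ^+ q.+1 * (m%:R * t0) ^+ (2 * q.+1) / (4 * m%:R * K ^+ 2) ^+ q.+1.
  rewrite exprM -exprMn -expr_div_n; congr (_ ^+ _); rewrite /z.
  by field; rewrite !gt_eqF.
rewrite {}zE; move: h (exprn_gt0 q.+1 b0); set v := (m%:R * t0) ^+ _; set w := _ ^+ q.+1.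
set u := (2 / 3) ^+ _; set B := #|_|%:R; set f := q.+1`!%:R => h w0.
have -> : B * (u * v / w / f) = u * (B * v / (w * f)) by field; rewrite !gt_eqF.
rewrite [leRHS]mulrC ler_wpM2l ?exprn_ge0 ?divr_ge0 //.
by rewrite ler_pdivrMr ?mulr_gt0 // [leRHS]mulrC.
Qed.

Lemma geometric_sum_le Q : \sum_(q < Q) (2 / 3) ^+ q <= 3 :> R.
Proof.
suff -> : \sum_(q < Q) (2 / 3) ^+ q = 3 * (1 - (2 / 3) ^+ Q) :> R.
  by rewrite ler_piMr // lerBlDr lerDl exprn_ge0 // divr_ge0.
elim: Q => [|Q IH]; first by rewrite big_ord0 expr0 subrr mulr0.
by rewrite big_ord_recr /= IH exprS; field.
Qed.

Theorem card_bad_sample_le :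
  #|[predC sample_good]|%:R * expR (m%:R * t0 ^+ 2 / (6 * K ^+ 2)) <=
  2 * p%:R * #|{: T}|%:R.
Proof.
rewrite -/z; have [->|b0] := eqVneq #|[predC sample_good]| 0%N; first by rewrite mul0r !mulr_ge0.
have bR : 0 < #|[predC sample_good]|%:R :> R by rewrite ltr0n lt0n.
(* The exponential is the limit of its partial sums, so a bound uniform in [Q] suffices. The
   coefficients total at most [1 + 3], and half of that is the constant 2. *)
rewrite -ler_pdivlMl //; apply: limr_le; first exact: is_cvg_series_exp_coeff.
near=> Q; rewrite ler_pdivlMl // /series /= big_mkord mulr_sumr.
have h0 (q : 'I_Q) := card_bad_coeff_le q.
apply: le_trans (ler_sum _ (fun q _ => h0 q)) _.
rewrite -mulr_sumr big_split /=.
have h1 : \sum_(q < Q) (q == 0 :> nat)%N%:R <= 1 :> R.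
  case: (Q) => [|Q']; first by rewrite big_ord0.
  by rewrite big_ord_recl big1 // addr0.
have -> : 2 * p%:R * #|{: T}|%:R = p%:R * #|{: T}|%:R / 2 * (1 + 3) :> R by field.
by rewrite ler_wpM2l ?divr_ge0 ?mulr_ge0 // lerD // geometric_sum_le.
Unshelve. all: by end_near.
Qed.

End MatrixSampling.

(** * Gradients, Hessians and derivatives along lines *)

Section LineDerivatives.
Context {R : realType} {p : nat}.
Notation V := 'cV[R]_p.
Implicit Types (f : V -> R) (x u v w : V).

Lemma cV_sum_ebasis v : v = \sum_i v i ord0 *: ebasis R i.
Proof.
by rewrite [LHS]matrix_sum_delta; apply: eq_bigr => i _; rewrite big_ord1.
Qed.

Lemma dot_grad f x v : dot (grad f x) v = 'd f x v.
Proof.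
rewrite {2}[v]cV_sum_ebasis linear_sum dotE; apply: eq_bigr => i _.
by rewrite linearZ mxE mulrC.
Qed.

Lemma Hess_mulmx f x v : Hess f x *m v = 'd (grad f) x v.
Proof.
rewrite {2}[v]cV_sum_ebasis linear_sum; apply/colP => i; rewrite mxE summxE.
by apply: eq_bigr => j _; rewrite linearZ !mxE mulrC.
Qed.

Lemma is_derive_line (W : normedModType R) (g : V -> W) x v (t : R) :
  differentiable g (x + t *: v) ->
  is_derive t 1 (fun s : R => g (x + s *: v)) ('d g (x + t *: v) v).
Proof.
move=> dg; have da : is_diff t (cst x + ( *:%R^~ v)) (0 + *:%R^~ v).
  by apply: is_diffD.
have dg' : is_diff ((cst x + ( *:%R^~ v)) t) g ('d g (x + t *: v)).
  exact: differentiableP.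
have dc := is_diff_comp da dg'.
apply: DeriveDef.
  by apply/derivable1_diffP; exact: (@ex_diff _ _ _ _ _ _ _ dc).
rewrite deriveE; last exact: (@ex_diff _ _ _ _ _ _ _ dc).
by rewrite (@diff_val _ _ _ _ _ _ _ dc) /= add0r scale1r.
Qed.

Lemma is_derive_dot (g : R -> V) (dg : V) w (t : R) :
  is_derive t 1 g dg -> is_derive t 1 (fun s => dot (g s) w) (dot dg w).
Proof.
move=> [g1 <-]; have gi i : is_derive t 1 (fun s => g s i ord0) (('D_1 g t) i ord0).
  apply: DeriveDef; first by move/derivable_mxP : g1; apply.
  by rewrite derive_mx // mxE.
have -> : (fun s => dot (g s) w) = \sum_i (w i ord0 \*: (fun s => g s i ord0)).
  by apply/funext => s; rewrite dotE fct_sumE; apply: eq_bigr => i _; rewrite mulrC.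
have -> : dot ('D_1 g t) w = \sum_i w i ord0 *: ('D_1 g t) i ord0.
  by rewrite dotE; apply: eq_bigr => i _; rewrite mulrC.
by apply: is_derive_sum => i; exact: is_deriveZ.
Qed.

Lemma mean_value_seg (g dg : R -> R) (a b : R) : a < b ->
  (forall t, a <= t <= b -> is_derive t 1 g (dg t)) ->
  exists2 c, a < c < b & g b - g a = dg c * (b - a).
Proof.
move=> ab dgt; have [||c] := @MVT R g dg a b ab.
- by move=> t; rewrite in_itv /= => /andP[/ltW ? /ltW ?]; apply: dgt; apply/andP.
- apply: derivable_within_continuous => t; rewrite in_itv /= => /dgt h.
  exact: ex_derive.
- by rewrite in_itv /= => cab e; exists c.
Qed.

(** Serves to differentiate the gradient of the average, whose formula is established only on the
    open set [D]. *)
Lemma near_eq_diff (W : normedModType R) (f g : V -> W) x :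
  (\forall y \near x, f y = g y) -> differentiable g x -> 'd f x = 'd g x :> (V -> W).
Proof.
move=> fg /diff_locallyP [dgc /eqaddoP dg]; apply: diff_unique => //.
have fg0 : \forall h \near (0 : V), f (h + x) = g (h + x).
  by move: fg; rewrite (near_shift 0 x) subr0.
apply/eqaddoP => e e0; near=> h; rewrite !fctE /=.
have -> : f x = g x by exact: nbhs_singleton fg.
have -> : f (h + x) = g (h + x) by near: h.
by near: h; apply: dg.
Unshelve. all: by end_near.
Qed.

End LineDerivatives.

(** * Symmetry of the Hessian and Taylor remainder of the gradient *)

Section SecondOrder.
Context {R : realType} {p : nat}.
Notation V := 'cV[R]_p.
Implicit Types (f : V -> R) (D C : set V) (x u v w : V).

Lemma norm_entry_le u i : `|u i ord0| <= `|u|.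
Proof.
by rewrite [leRHS]/Num.norm /= mx_normrE; apply/bigmax_geP; right => /=; exists (i, ord0).
Qed.

Lemma norm_dot_mx_le u v : `|dot u v| <= p%:R * (`|u| * `|v|).
Proof.
rewrite dotE; apply: le_trans (ler_norm_sum _ _ _) _.
have -> : p%:R * (`|u| * `|v|) = \sum_(i < p) `|u| * `|v| by rewrite sumr_const card_ord mulr_natl.
apply: ler_sum => i _.
by rewrite normrM ler_pM // norm_entry_le.
Qed.

Lemma diff_expansion (g : V -> V) x : differentiable g x -> forall e, 0 < e ->
  exists2 d, 0 < d & forall h, `|h| < d -> `|g (x + h) - g x - 'd g x h| <= e * `|h|.
Proof.
move=> /diff_locallyP [_ /eqaddoP dg] e e0.
have /nbhs_norm0P [d /= d0 hd] := dg e e0; exists d => // h hh.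
by have := hd h hh; rewrite !fctE /= opprD addrA [h + x]addrC.
Qed.

Lemma is_derive_line_grad f x v (t : R) : differentiable f (x + t *: v) ->
  is_derive t 1 (fun s : R => f (x + s *: v)) (dot (grad f (x + t *: v)) v).
Proof. by rewrite dot_grad; exact: is_derive_line. Qed.

(** The mean value theorem along [v] turns the second difference into a difference of two gradients,
    each of which is then expanded to first order at [x]. *)
Lemma second_difference f D x : open D -> (forall y, D y -> differentiable f y) ->
  D x -> differentiable (grad f) x -> forall u v (e : R), 0 < e ->
  exists2 s0, 0 < s0 & forall s, 0 < s < s0 ->
  `|f (x + s *: u + s *: v) - f (x + s *: u) - f (x + s *: v) + f x
    - s ^+ 2 * dot (Hess f x *m u) v| <= e * s ^+ 2.
Proof.
move=> oD df Dx dgf u v e e0.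
have [r r0 hr] : exists2 r, 0 < r & forall h, `|h| < r -> D (x + h).
  have : nbhs x D by exact: open_nbhs_nbhs.
  move=> /nbhs_normP [r /= r0 hr]; exists r => // h hh; apply: hr.
  by rewrite /= opprD addNKr normrN.
pose N := `|u| + `|v| + 1; have N0 : 0 < N by rewrite ltr_wpDl // addr_ge0.
have uN : `|u| <= N by rewrite /N -addrA lerDl addr_ge0.
have vN : `|v| <= N by rewrite /N [`|u| + _]addrC -addrA lerDl addr_ge0.
have uvN : `|u| + `|v| <= N by rewrite /N lerDl.
(* [K e' s^2] will be the total of the two remainders; dividing by [K + 1] avoids a zero
   denominator. *)
pose K := 2 * p%:R * N ^+ 2; have K0 : 0 <= K by rewrite mulr_ge0 ?sqr_ge0 // mulr_ge0.
pose e' := e / (K + 1); have e'0 : 0 < e' by rewrite divr_gt0 // ltr_wpDl.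
have [d d0 hd] := diff_expansion dgf e'0.
have m0 : 0 < Num.min d r by rewrite lt_min d0.
exists (Num.min d r / N); first by rewrite divr_gt0.
move=> s /andP[s0]; rewrite ltr_pdivlMr // lt_min => /andP[sd sr].
have bnd a b : 0 <= a <= s -> 0 <= b <= s -> `|a *: u + b *: v| <= s * N.
  move=> /andP[a0 a1] /andP[b0 b1]; apply: le_trans (ler_normD _ _) _.
  rewrite !normrZ !ger0_norm //; apply: le_trans (_ : s * `|u| + s * `|v| <= _).
    by rewrite lerD // ler_wpM2r.
  by rewrite -mulrDr ler_wpM2l // ltW.
have inD a b : 0 <= a <= s -> 0 <= b <= s -> D (x + a *: u + b *: v).
  by move=> ha hb; rewrite -addrA; apply: hr; apply: le_lt_trans (bnd _ _ ha hb) _.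
pose g t := f (x + s *: u + t *: v) - f (x + t *: v).
pose dg t := dot (grad f (x + s *: u + t *: v)) v - dot (grad f (x + t *: v)) v.
have ss : 0 <= s <= s by rewrite lexx ltW.
have zs : 0 <= (0 : R) <= s by rewrite lexx ltW.
have [|c /andP[c0 cs] gc] := @mean_value_seg R g dg 0 s s0.
  move=> t ht; apply: is_deriveB; apply: is_derive_line_grad; apply: df; first exact: inD.
  by have := inD 0 t zs ht; rewrite scale0r addr0.
have cc : 0 <= c <= s by rewrite !ltW.
have -> : f (x + s *: u + s *: v) - f (x + s *: u) - f (x + s *: v) + f x = dg c * s.
  by rewrite -[X in _ * X]subr0 -gc /g !scale0r !addr0; ring.
have rest h : `|h| <= s * N -> `|dot (grad f (x + h) - grad f x - Hess f x *m h) v|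
    <= p%:R * (e' * (s * N) * N).
  move=> hs; rewrite Hess_mulmx; apply: le_trans (norm_dot_mx_le _ _) _.
  rewrite ler_wpM2l // ler_pM //; apply: le_trans (hd _ _) _.
    exact: le_lt_trans hs _.
  by rewrite ler_wpM2l // ltW.
have r1 := rest _ (bnd s c ss cc); have r2 := rest _ (bnd 0 c zs cc).
(* In the difference of the two expansions [grad f x] and the terms [c H v] cancel, leaving
   [s H u]. *)
have -> : dg c * s - s ^+ 2 * dot (Hess f x *m u) v =
   s * (dot (grad f (x + (s *: u + c *: v)) - grad f x - Hess f x *m (s *: u + c *: v)) v
      - dot (grad f (x + (0 *: u + c *: v)) - grad f x - Hess f x *m (0 *: u + c *: v)) v).
  have alg (a b g0 Hu Hv : V) : (dot a v - dot b v) * s - s ^+ 2 * dot Hu v =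
      s * (dot (a - g0 - (s *: Hu + c *: Hv)) v - dot (b - g0 - c *: Hv) v).
    by rewrite !(dotDl, dotNl, dotZl); ring.
  rewrite /dg scale0r add0r mulmxDr -!scalemxAr addrA; exact: alg.
rewrite normrM gtr0_norm //; apply: le_trans (ler_wpM2l (ltW s0) (ler_normB _ _)) _.
apply: le_trans (ler_wpM2l (ltW s0) (lerD r1 r2)) _.
have -> : s * (p%:R * (e' * (s * N) * N) + p%:R * (e' * (s * N) * N)) = K * e' * s ^+ 2.
  by rewrite /K; ring.
rewrite ler_wpM2r ?sqr_ge0 // /e' mulrA ler_pdivrMr ?ltr_wpDl //.
by rewrite mulrC ler_wpM2l ?ltW // ltrDl.
Qed.

(** The second difference is unchanged when [u] and [v] are exchanged, so its two quadratic
    approximations must agree. *)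
Theorem Hess_sym f D x : open D -> twice_diff_on D f -> D x -> (Hess f x)^T = Hess f x.
Proof.
move=> oD df Dx; have df1 y : D y -> differentiable f y by case/df.
have [_ dgf] := df x Dx.
suff sym u v : dot (Hess f x *m u) v = dot (Hess f x *m v) u.
  by apply/matrixP => i j; rewrite mxE -!dot_delta dotC sym dotC.
have [A AE] : exists A, A = dot (Hess f x *m u) v by eexists.
have [B BE] : exists B, B = dot (Hess f x *m v) u by eexists.
rewrite -AE -BE; apply/eqP; rewrite -subr_eq0 -normr_le0 leNgt; apply/negP => a0.
have [a aE] : exists a, a = `|A - B| by eexists.
(* With a quarter of the supposed gap [a] as tolerance, the two errors add up to [a/2], less than
   [a]. *)
rewrite -aE in a0; have a4 : 0 < a / 4 by rewrite divr_gt0.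
have [s1 s10 h1] := second_difference oD df1 Dx dgf u v a4.
have [s2 s20 h2] := second_difference oD df1 Dx dgf v u a4.
pose s := Num.min s1 s2 / 2.
have m0 : 0 < Num.min s1 s2 by rewrite lt_min s10.
have s0 : 0 < s by rewrite divr_gt0.
have sm : s < Num.min s1 s2 by rewrite /s ltr_pdivrMr // ltr_pMr // ltr1n.
have {}h1 : _ := h1 s; have {}h2 := h2 s; move: sm; rewrite lt_min => /andP[sm1 sm2].
move: h1 h2; rewrite s0 sm1 sm2 => /(_ isT) h1 /(_ isT) h2.
have := lerD h1 h2 => /(le_trans (ler_normB _ _)).
rewrite [x + s *: v + s *: u]addrAC.
rewrite -AE -BE; move: (f (x + s *: u + s *: v)) (f (x + s *: u)) (f (x + s *: v)) (f x) => q1 q2 q3 q4.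
have -> : q1 - q2 - q3 + q4 - s ^+ 2 * A - (q1 - q3 - q2 + q4 - s ^+ 2 * B)
  = s ^+ 2 * (B - A) by ring.
rewrite normrM (ger0_norm (sqr_ge0 s)) distrC -aE -mulrDl mulrC ler_pM2r ?exprn_gt0 //.
by rewrite leNgt => /negP; apply; rewrite -mulrDl ltr_pdivrMr //; lra.
Qed.

Lemma is_derive_mulr (k t : R) : is_derive t 1 (fun s => s * k) k.
Proof.
apply: is_derive_eq (is_deriveM (is_derive_id t 1) (is_derive_cst k t 1)) _.
by rewrite /= /GRing.scale /= mulr0 add0r mulr1.
Qed.

Lemma is_derive_half_sqr (c t : R) : is_derive t 1 (fun s => c / 2 * s ^+ 2) (c * t).
Proof.
apply: is_derive_eq (is_deriveZ (c / 2) (is_deriveM (is_derive_id t 1) (is_derive_id t 1))) _.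
by rewrite /= /GRing.scale /=; field.
Qed.

(** Subtracting the primitive [c/2 t^2] before applying the mean value theorem produces the factor
    [1/2] without integrating the Hessian. *)
Lemma grad_remainder f x e w c : (forall t, 0 <= t <= 1 -> differentiable (grad f) (x + t *: e)) ->
  (forall t, 0 <= t <= 1 -> dot ((Hess f (x + t *: e) - Hess f x) *m e) w <= c * t) ->
  dot (grad f (x + e) - grad f x - Hess f x *m e) w <= c / 2.
Proof.
move=> dgf hc; pose g t := dot (grad f (x + t *: e)) w - t * dot (Hess f x *m e) w.
pose dg t := dot (Hess f (x + t *: e) *m e) w - dot (Hess f x *m e) w.
pose g' := g - (fun t => c / 2 * t ^+ 2).
have [|t /andP[t0 t1]] := @mean_value_seg R g' (fun t => dg t - c * t) 0 1 ltr01.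
  move=> t ht; apply: is_deriveB; last exact: is_derive_half_sqr.
  apply: is_deriveB; last exact: is_derive_mulr.
  by rewrite Hess_mulmx; apply: is_derive_dot; apply: is_derive_line; exact: dgf.
have e1 : g' 1 = dot (grad f (x + e)) w - dot (Hess f x *m e) w - c / 2.
  by rewrite /g' /g !fctE scale1r mul1r expr1n mulr1.
have e0 : g' 0 = dot (grad f x) w.
  by rewrite /g' /g !fctE scale0r mul0r expr0n mulr0 addr0 !subr0.
have tt : 0 <= t <= 1 by rewrite !ltW.
have alg (a b h k : R) : a - h - c / 2 - b = (k - h - c * t) * (1 - 0) ->
    k - h <= c * t -> a - b - h <= c / 2.
  by clear; move=> *; lra.
rewrite e1 e0 /dg !dotBl => /alg; apply.
by move: (hc t tt); rewrite mulmxBl dotBl.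
Qed.

End SecondOrder.

(** * First-order optimality conditions over convex sets *)

Section Optimality.
Context {R : realType} {p : nat}.
Notation V := 'cV[R]_p.
Implicit Types (C D : set V) (x y z g : V) (M : 'M[R]_p).

Lemma convexI C D : convex_in C -> convex_in D -> convex_in (C `&` D).
Proof. by move=> cC cD x y t [Cx Dx] [Cy Dy] t01; split; [exact: cC | exact: cD]. Qed.

Lemma convex_line C x y (t : R) : convex_in C -> C x -> C y -> 0 <= t <= 1 ->
  C (x + t *: (y - x)).
Proof.
move=> cC Cx Cy t01; have := cC y x t Cy Cx t01.
by rewrite scalerBl scale1r scalerBr addrCA.
Qed.

Lemma local_min_grad_ge0 C (F : V -> R) x y : convex_in C -> local_min_on C F x ->
  differentiable F x -> C y -> 0 <= dot (grad F x) (y - x).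
Proof.
move=> cC [Cx minx] dF Cy; rewrite leNgt; apply/negP => a0.
set e := y - x in a0; set a := dot _ _ in a0.
have [dphi phia] : is_derive (0 : R) 1 (fun s => F (x + s *: e)) a.
  rewrite /a; have -> : grad F x = grad F (x + 0 *: e) by rewrite scale0r addr0.
  by apply: is_derive_line_grad; rewrite scale0r addr0.
have neg : \forall h \near (0 : R)^', h^-1 *: (F (x + (h *: 1 + 0) *: e) - F (x + 0 *: e)) < 0.
  by apply: (cvgr_lt a) => //; rewrite -phia; exact: dphi.
have /nbhs_norm0P [d /= d0 hd] := neg.
have /nbhs_normP [r /= r0 hr] := minx.
have e1 : 0 < `|e| + 1 by rewrite ltr_wpDl.
(* The three bounds keep [h] in the range of the difference quotient, on the segment, and inside the
   ball of local minimality. *)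
pose m := Num.min d (Num.min 1 (r / (`|e| + 1))).
have m0 : 0 < m by rewrite !lt_min d0 ltr01 divr_gt0.
pose h := m / 2; have h0 : 0 < h by rewrite divr_gt0.
have : h < m by rewrite ltr_pdivrMr // ltr_pMr // ltr1n.
rewrite !lt_min => /and3P[hd1 h1 hr1].
have Ch : C (x + h *: e) by apply: convex_line => //; rewrite !ltW.
have := hd h; rewrite /= gtr0_norm // => /(_ hd1 (lt0r_neq0 h0)).
rewrite addr0 scale0r addr0 [h *: 1]mulr1 pmulr_rlt0 ?invr_gt0 // subr_lt0 ltNge => /negP; apply.
apply: hr => //=; rewrite opprD addNKr normrN normrZ gtr0_norm //.
apply: le_lt_trans (_ : h * (`|e| + 1) < r); last by rewrite -ltr_pdivlMr.
by apply: ler_wpM2l; [exact: ltW | rewrite lerDl].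
Qed.

Lemma qmodelE (c : R) x g M y : qmodel c x g M y =
  c + dot (y - x) g + 2^-1 * dot (y - x) (M *m (y - x)).
Proof. by rewrite /qmodel -mulmxA. Qed.

Lemma qmodel_line (c t : R) x g M y e : M^T = M ->
  qmodel c x g M (y + t *: e) - qmodel c x g M y =
  t * dot (g + M *m (y - x)) e + t ^+ 2 * dot e (M *m e) / 2.
Proof.
move=> sM; rewrite !qmodelE [y + t *: e - x]addrAC; move: (y - x) => w.
rewrite mulmxDr -scalemxAr !(dotDl, dotDr, dotZl, dotZr) (dotC e g) (dotC (M *m _) e).
rewrite (dot_sym w e sM).
move: (dot w g) (dot g e) (dot w (M *m w)) (dot e (M *m w)) (dot e (M *m e)) => q1 q2 q3 q4 q5.
by field.
Qed.

Lemma argmin_qmodel_ge0 C (c : R) x g M y z : convex_in C -> M^T = M ->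
  is_argmin C (qmodel c x g M) y -> C z -> 0 <= dot (g + M *m (y - x)) (z - y).
Proof.
move=> cC sM [Cy miny] Cz; set e := z - y; set b := dot e (M *m e).
rewrite leNgt; apply/negP; set a := dot _ e => a0.
have b1 : 0 < `|b| + 1 by rewrite ltr_wpDl.
(* This step length keeps the quadratic term at most half the size of the linear one, so the model
   would change by at most [t a / 2 < 0]. *)
pose t := Num.min 1 (- a / (`|b| + 1)).
have t0 : 0 < t by rewrite lt_min ltr01 divr_gt0 // oppr_gt0.
have t1 : t <= 1 by rewrite ge_min lexx.
have tb : t * b <= - a.
  apply: le_trans (_ : t * (`|b| + 1) <= _).
    by apply: ler_wpM2l; [exact: ltW | rewrite (le_trans (ler_norm _)) // lerDl].
  by rewrite -ler_pdivlMr // /t ge_min lexx orbT.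
have := miny (y + t *: e).
have Ct : C (y + t *: e) by apply: convex_line => //; rewrite t1 ltW.
move=> /(_ Ct); rewrite -subr_ge0 qmodel_line // -/a -/b.
have -> : t * a + t ^+ 2 * b / 2 = t * (a + t * b / 2) by ring.
rewrite pmulr_rge0 // leNgt => /negP; apply.
by move: a0 tb; clear; move: (t * b) => s *; lra.
Qed.

End Optimality.

(** * Derivatives of the averaged function *)

Section Averages.
Context {R : realType} {p n : nat}.
Notation V := 'cV[R]_p.
Variables (f : 'I_n -> V -> R) (D : set V).
Hypotheses (oD : open D) (hf : forall i, twice_diff_on D (f i)).

Lemma is_diff_avg (W : normedModType R) (F : 'I_n -> V -> W) x :
  (forall i, differentiable (F i) x) ->
  is_diff x (n%:R^-1 \*: \sum_i F i) (n%:R^-1 \*: \sum_i ('d (F i) x : V -> W)).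
Proof.
move=> dF; apply: is_diffZ.
elim/big_ind2 : _ => [|f1 df1 f2 df2 h1 h2|i _].
- exact: is_diff_cst.
- exact: is_diffD.
- exact: differentiableP.
Qed.

Lemma diff_avg (W : normedModType R) (F : 'I_n -> V -> W) x v :
  (forall i, differentiable (F i) x) ->
  'd (n%:R^-1 \*: \sum_i F i) x v = n%:R^-1 *: \sum_i 'd (F i) x v.
Proof.
move=> dF; have dA := is_diff_avg dF.
by rewrite (@diff_val _ _ _ _ _ _ _ dA) /= fct_sumE.
Qed.

Lemma FavgE : Favg f = n%:R^-1 \*: \sum_i f i.
Proof. by apply/funext => x; rewrite /Favg /= fct_sumE. Qed.

Lemma differentiable_Favg x : D x -> differentiable (Favg f) x.
Proof.
move=> Dx; rewrite FavgE.
have dA := @is_diff_avg _ f x (fun i => (hf i Dx).1).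
exact: (@ex_diff _ _ _ _ _ _ _ dA).
Qed.

Lemma grad_Favg x : D x -> grad (Favg f) x = n%:R^-1 *: \sum_i grad (f i) x.
Proof.
move=> Dx; apply/colP => j; rewrite !mxE FavgE diff_avg => [|i]; last by case: (hf i Dx).
by rewrite summxE; congr (_ * _); apply: eq_bigr => i _; rewrite mxE.
Qed.

Lemma Hess_Favg x : D x -> Hess (Favg f) x = n%:R^-1 *: \sum_i Hess (f i) x.
Proof.
move=> Dx; have dg i : differentiable (grad (f i)) x by case: (hf i Dx).
have near_grad : \forall y \near x,
    grad (Favg f) y = (n%:R^-1 \*: \sum_i grad (f i)) y.
  have : nbhs x D by exact: open_nbhs_nbhs.
  by apply: filterS => y Dy; rewrite grad_Favg //= fct_sumE.
have dA := is_diff_avg dg; have dA1 := @ex_diff _ _ _ _ _ _ _ dA.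
apply/matrixP => i j; rewrite !mxE (near_eq_diff near_grad dA1) diff_avg //.
by rewrite !mxE !summxE; congr (_ * _); apply: eq_bigr => k _; rewrite mxE.
Qed.

End Averages.

(** * Numerical inequalities for one step *)

Section StepArithmetic.
Context {R : realType}.
Implicit Types (q eps gam l mu lam a b : R).

(** Here [q] is [6 sqrt p], [l] is [L |e|] and [mu] is the smallest eigenvalue of the first
    sub-sampled Hessian. The lower bound on [mu] yields [gam (q+2)(1-eps0) <= (q+3) mu], which
    absorbs the prefactor of the threshold. *)
Lemma threshold_gt q eps (eps0 : R) gam l mu lam : 6 <= q -> 0 < eps0 < 1 -> eps < 1 -> 0 < gam ->
  l * (q + 3) <= gam -> gam - 5 / 8 * eps0 * gam - l <= mu ->
  ((q + 3) * (1 - eps)) / ((q + 2) * (1 - eps0)) * mu < lam -> (1 - eps) * gam < lam.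
Proof.
move=> q6 /andP[e00 e01] e1 g0 lq mul; apply: le_lt_trans.
have d0 : 0 < (q + 2) * (1 - eps0) by rewrite mulr_gt0 //; lra.
rewrite mulrAC ler_pdivlMr //.
suff key : gam * ((q + 2) * (1 - eps0)) <= (q + 3) * mu.
  rewrite -mulrA [(q + 3) * _]mulrC -[_ * mu]mulrA; apply: ler_wpM2l => //; lra.
have h : (q + 3) * (gam - 5 / 8 * eps0 * gam - l) <= (q + 3) * mu.
  by apply: ler_wpM2l => //; lra.
apply: le_trans h; rewrite -subr_ge0.
have -> : (q + 3) * (gam - 5 / 8 * eps0 * gam - l) - gam * ((q + 2) * (1 - eps0)) =
  (gam - l * (q + 3)) + 3 / 8 * (q + 1 / 3) * (eps0 * gam) by field.
apply: addr_ge0; first by rewrite subr_ge0.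
apply: mulr_ge0; last by apply: mulr_ge0; exact: ltW.
lra.
Qed.

(** Here [y] is [eps gam]. If the first argument attains the maximum, the losses are
    [5/4 y + 5/2 l <= 35/72 gam]; otherwise [lam > gam - y] reduces the claim to
    [13/8 y + 3/2 l <= 7/16 gam]. Both are below [gam / 2]. *)
Lemma step_coefficient_le gam y l lam : 0 < gam -> 0 <= y -> y <= gam / 6 -> 0 <= l ->
  l <= gam / 9 -> gam - y < lam ->
  Num.max (lam - (gam - 5 / 8 * y - l)) 0 + l + 5 / 8 * y + l / 2 <= lam - gam / 2.
Proof.
by move=> ? ? ? ? ? ?; have [?|?] := leP (lam - (gam - 5 / 8 * y - l)) 0; lra.
Qed.

Lemma contraction_of_form lam gam (k : R) a b : 0 < lam -> gam <= 2 * lam ->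
  0 <= a -> 0 <= b -> k <= lam - gam / 2 -> lam * a ^+ 2 <= k * (a * b) -> a <= (1 - gam / (2 * lam)) * b.
Proof.
move=> l0 gl a0 b0 kl h; have {}h : lam * a ^+ 2 <= (lam - gam / 2) * (a * b).
  by apply: le_trans h _; rewrite ler_wpM2r // mulr_ge0.
have [a00|an] := eqVneq a 0.
  by rewrite a00 mulr_ge0 // subr_ge0 ler_pdivrMr ?mulr_gt0 // mul1r.
have ap : 0 < a by rewrite lt_neqAle eq_sym an.
rewrite -(ler_pM2l l0) -(ler_pM2l ap).
have -> : a * (lam * ((1 - gam / (2 * lam)) * b)) = (lam - gam / 2) * (a * b).
  by field; rewrite gt_eqF.
by have -> : a * (lam * a) = lam * a ^+ 2 by ring.
Qed.

End StepArithmetic.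

(** * One step of the method *)

Section NewtonStep.
Context {R : realType} {p n : nat}.
Notation V := 'cV[R]_p.

(** With [e] and [a] the old and new errors, the condition at the new iterate is tested at the
    minimizer, the condition at the minimizer is tested at the new iterate, and the two are
    added. *)
Lemma optimality_form (a e g gs : V) (M G : 'M[R]_p) :
  0 <= dot (g + M *m (a - e)) (- a) -> 0 <= dot gs a ->
  dot a (M *m a) <= dot a ((M - G) *m e) + dot (g - gs - G *m e) (- a).
Proof.
rewrite mulmxBr mulmxBl !(dotNr, dotDl, dotDr, dotNl).
rewrite (dotC (M *m a) a) (dotC (M *m e) a) (dotC (G *m e) a) (dotC g a) (dotC gs a).
move: (dot a g) (dot a (M *m a)) (dot a (M *m e)) (dot a (G *m e)) (dot a gs).
by clear; move=> *; lra.
Qed.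

Variables (f : 'I_n -> V -> R) (D X : set V) (xs : V) (L : R).
Hypotheses (p0 : (0 < p)%N) (n0 : (0 < n)%N) (L0 : 0 < L).
Hypotheses (oD : open D) (cD : convex_in D) (cX : convex_in X).
Hypothesis hf : forall i, twice_diff_on D (f i).
Hypothesis xs_min : local_min_on (D `&` X) (Favg f) xs.
Hypothesis hLip : forall x i, D x -> X x ->
  specnorm (Hess (f i) x - Hess (f i) xs) <= L * enorm (x - xs).

Let F := Favg f.
Let G := Hess F xs.
Let Dxs : D xs. Proof. by case: xs_min => -[]. Qed.
Let Xxs : X xs. Proof. by case: xs_min => -[]. Qed.
Let cDX : convex_in (D `&` X). Proof. exact: convexI. Qed.

Lemma subHess_sym m (S : m.-tuple 'I_n) x : D x -> (subHess f S x)^T = subHess f S x.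
Proof.
move=> Dx; rewrite /subHess linearZ linear_sum /=; congr (_ *: _).
by apply: eq_bigr => t _; exact: (Hess_sym oD (hf _) Dx).
Qed.

Lemma Hess_Favg_sym x : D x -> (Hess F x)^T = Hess F x.
Proof.
move=> Dx; rewrite (Hess_Favg oD hf Dx) linearZ linear_sum /=; congr (_ *: _).
by apply: eq_bigr => t _; exact: (Hess_sym oD (hf _) Dx).
Qed.

Lemma subHess_lip m (S : m.-tuple 'I_n) x : (0 < m)%N -> D x -> X x ->
  form_le (subHess f S x - subHess f S xs) (L * enorm (x - xs)).
Proof.
move=> m0 Dx Xx; rewrite /subHess -scalerBr -sumrB; apply: form_le_avg => // t.
by apply: form_le_specnorm; exact: hLip.
Qed.

(** (LipS) bears on each summand, so the remainder is bounded for each [f i] along the segment and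
    then averaged. *)
Lemma grad_Favg_remainder x w : D x -> X x ->
  dot (grad F x - grad F xs - G *m (x - xs)) w <=
  L / 2 * enorm (x - xs) * (enorm (x - xs) * enorm w).
Proof.
move=> Dx Xx; have [e xE] : exists e, x = xs + e by exists (x - xs); rewrite addrCA subrr addr0.
have -> : x - xs = e by rewrite xE addrAC subrr add0r.
have each i : dot (grad (f i) x - grad (f i) xs - Hess (f i) xs *m e) w <=
    L / 2 * enorm e * (enorm e * enorm w).
  have eE : e = x - xs by rewrite xE addrAC subrr add0r.
  have onD t : 0 <= t <= 1 -> D (xs + t *: e) by rewrite eE => ht; exact: convex_line.
  have onX t : 0 <= t <= 1 -> X (xs + t *: e) by rewrite eE => ht; exact: convex_line.
  rewrite xE; have -> : L / 2 * enorm e * (enorm e * enorm w) =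
    L * enorm e * (enorm e * enorm w) / 2 by field.
  apply: grad_remainder => [t /onD Dt|t ht]; first by case: (hf i Dt).
  have /andP[t0 _] := ht; rewrite dotC.
  have h : form_le (Hess (f i) (xs + t *: e) - Hess (f i) xs) (L * (t * enorm e)).
    apply: form_le_specnorm; apply: le_trans (hLip i (onD t ht) (onX t ht)) _.
    by rewrite [_ - xs]addrAC subrr add0r enormZ ger0_norm.
  apply: le_trans (h w e) _; move: (enorm e) (enorm w) => a b.
  by rewrite le_eqVlt; apply/orP; left; apply/eqP; ring.
have -> : grad F x - grad F xs - G *m e =
    n%:R^-1 *: \sum_i (grad (f i) x - grad (f i) xs - Hess (f i) xs *m e).
  rewrite /G (grad_Favg hf Dx) (grad_Favg hf Dxs) (Hess_Favg oD hf Dxs).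
  by rewrite -scalemxAl mulmx_suml !sumrB !scalerBr.
have nR : 0 < n%:R :> R by rewrite ltr0n.
rewrite dotZl dotC dot_sumr ler_pdivrMl // mulr_natl.
have -> : L / 2 * enorm e * (enorm e * enorm w) *+ n =
   \sum_(i < n) L / 2 * enorm e * (enorm e * enorm w) by rewrite sumr_const card_ord.
by apply: ler_sum => i _; rewrite dotC.
Qed.

Variables (gam eps eps0 : R).
Hypotheses (gamE : gam = lmin G) (gam0 : 0 < gam).
Hypotheses (heps : 0 < eps) (heps6 : eps <= 6^-1) (heps0 : 0 < eps0 < 1).

Lemma quad_Hess_ge m (S : m.-tuple 'I_n) x c : (0 < m)%N -> D x -> X x ->
  form_le (subHess f S xs - G) c -> forall v,
  (gam - c - L * enorm (x - xs)) * enorm v ^+ 2 <= dot v (subHess f S x *m v).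
Proof.
move=> m0 Dx Xx hc v.
have h1 := form_le_lower v (subHess_lip S m0 Dx Xx); have h2 := form_le_lower v hc.
have h3 := lmin_le_form (Hess_Favg_sym Dxs) v; rewrite -/G -gamE in h3.
have -> : dot v (subHess f S x *m v) = dot v ((subHess f S x - subHess f S xs) *m v)
    + dot v ((subHess f S xs - G) *m v) + dot v (G *m v).
  by rewrite -!dotDr -!mulmxDl addrA !subrK.
apply: le_trans (lerD (lerD h1 h2) h3); move: (enorm v) (enorm (x - xs)) => a b.
by rewrite le_eqVlt; apply/orP; left; apply/eqP; ring.
Qed.

(** The first conclusion is for the induction: it gives [0 < lam], hence a factor at most 1 and an
    error that stays small. *)
Theorem newton_step_contraction m0 (S0 : m0.-tuple 'I_n) m (S : m.-tuple 'I_n)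
    (x xn : V) (lam : R) M : (0 < m0)%N -> (0 < m)%N -> D x -> X x ->
  L * enorm (x - xs) * (6 * Num.sqrt p%:R + 3) <= gam ->
  form_le (subHess f S0 xs - G) (5 / 8 * eps0 * gam) ->
  form_le (subHess f S xs - G) (5 / 8 * eps * gam) ->
  ((6 * Num.sqrt p%:R + 3) * (1 - eps)) / ((6 * Num.sqrt p%:R + 2) * (1 - eps0))
    * lmin (subHess f S0 x) < lam ->
  spec_reg lam (subHess f S x) M ->
  is_argmin (D `&` X) (qmodel (F x) x (grad F x) M) xn ->
  (1 - eps) * gam < lam /\
  enorm (xn - xs) <= (1 - gam / (2 * lam)) * enorm (x - xs).
Proof.
move=> hm0 hm Dx Xx small good0 good hlam hM hmin.
set l := L * enorm (x - xs) in small *.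
have l0 : 0 <= l by rewrite mulr_ge0 ?enorm_ge0 // ltW.
have q6 : 6 <= 6 * Num.sqrt p%:R :> R.
  by rewrite ler_peMr // -[X in X <= _]sqrtr1 ler_wsqrtr // ler1n.
have e1 : eps < 1 by move: heps6; lra.
have mu0 : gam - 5 / 8 * eps0 * gam - l <= lmin (subHess f S0 x).
  apply: form_le_lmin => //; first exact: subHess_sym.
  exact: quad_Hess_ge.
have lam_gt := threshold_gt q6 heps0 e1 gam0 small mu0 hlam.
split=> //.
(* Since [p >= 1], the factor [6 sqrt p + 3] is at least 9. *)
have l9 : l <= gam / 9.
  rewrite ler_pdivlMr //; apply: le_trans small; rewrite ler_wpM2l //; move: q6; lra.
have y0 : 0 <= eps * gam by rewrite mulr_ge0 // ltW.
have y6 : eps * gam <= gam / 6 by rewrite mulrC ler_pM2l.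
have lamy : gam - eps * gam < lam by move: lam_gt; rewrite mulrBl mul1r.
have lam0 : 0 < lam by move: gam0 y6 lamy; lra.
apply: (contraction_of_form lam0 _ (enorm_ge0 _) (enorm_ge0 _)
  (step_coefficient_le gam0 y0 y6 l0 l9 lamy)).
  by move: gam0 y6 lamy; lra.
have mu1 := quad_Hess_ge hm Dx Xx good.
have MG : form_le (M - G)
    (Num.max (lam - (gam - 5 / 8 * (eps * gam) - l)) 0 + l + 5 / 8 * (eps * gam)).
  have split3 (A B C E : 'M[R]_p) : A - E = (A - B) + (B - C) + (C - E).
    by rewrite !addrA !subrK.
  rewrite (split3 _ (subHess f S x) (subHess f S xs)).
  rewrite (mulrA (5 / 8)); apply: form_leD; last by [].
  apply: form_leD; last exact: subHess_lip.
  by apply: spec_reg_sub hM _ => v; exact: mu1.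
have sM := spec_reg_sym hM.
have [[Dn Xn] _] := hmin.
have opt := argmin_qmodel_ge0 cDX sM hmin (conj Dxs Xxs).
have first := local_min_grad_ge0 cDX xs_min (differentiable_Favg hf Dxs) (conj Dn Xn).
have rem := grad_Favg_remainder (- (xn - xs)) Dx Xx; rewrite enormN in rem.
have hMG := MG (xn - xs) (x - xs).
have hlam2 := spec_reg_ge hM (xn - xs).
apply: le_trans hlam2 _.
rewrite mulrDl.
have rem' : dot (grad F x - grad F xs - G *m (x - xs)) (- (xn - xs)) <=
  l / 2 * (enorm (xn - xs) * enorm (x - xs)).
  by apply: le_trans rem _; rewrite le_eqVlt; apply/orP; left; apply/eqP; rewrite /l; ring.
apply: le_trans (lerD hMG rem'); apply: optimality_form first.
have -> : xn - xs - (x - xs) = xn - x by rewrite opprB addrA subrK.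
by rewrite opprB.
Qed.

End NewtonStep.

(** * Sample sizes and counting of good samples *)

Section SampleSize.
Context {R : realType} {p n : nat}.

(** Testing both bounds on a basis vector gives [gam <= K]. Positivity of [K] lets the concentration
    bound divide by [K^2]. *)
Lemma form_le_gt0 (G : 'M[R]_p) gam K : (0 < p)%N -> 0 < gam ->
  (forall v, gam * enorm v ^+ 2 <= dot v (G *m v)) -> form_le G K -> 0 < K.
Proof.
move=> p0 g0 hg hK; pose v : 'cV[R]_p := delta_mx (Ordinal p0) ord0.
have v0 : 0 < enorm v ^+ 2.
  rewrite exprn_gt0 // lt_neqAle eq_sym enorm_eq0 enorm_ge0 andbT.
  apply/eqP => /matrixP /(_ (Ordinal p0) ord0); rewrite !mxE !eqxx => /eqP.
  by rewrite oner_eq0.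
have := le_trans (hg v) (hK v v); rewrite -expr2 ler_pM2r //.
exact: lt_le_trans.
Qed.

Lemma card_good_sample_ge (A : 'I_n -> 'M[R]_p) (G : 'M[R]_p) (K gam eps delta : R) (m : nat) :
  (0 < p)%N -> (0 < n)%N -> 0 < K -> 0 < gam -> 0 < eps -> 0 < delta < 1 ->
  (forall i, (A i)^T = A i) -> (forall i, form_le (A i) K) -> n%:R *: G = \sum_i A i ->
  16 * K ^+ 2 * ln (2 * p%:R / delta) / (gam ^+ 2 * eps ^+ 2) <= m%:R ->
  (0 < m)%N /\ (1 - delta) * #|{: m.-tuple 'I_n}|%:R <=
    #|[pred S : m.-tuple 'I_n | sample_good A G (5 / 8 * eps * gam) S]|%:R.
Proof.
move=> p0 n0 K0 g0 e0 /andP[d0 d1] sA AK GE hm.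
have pR : 1 <= p%:R :> R by rewrite ler1n.
have r1 : 1 < 2 * p%:R / delta by rewrite ltr_pdivlMr // mul1r; lra.
have ln0 : 0 < ln (2 * p%:R / delta) by exact: ln_gt0.
(* As [2p/delta > 1], the logarithm is positive and the prescribed size excludes an empty sample. *)
have m0 : (0 < m)%N.
  by rewrite -(ltr0n R); apply: lt_le_trans hm; rewrite !(divr_gt0, mulr_gt0, exprn_gt0).
split=> //; set t0 := 5 / 8 * eps * gam.
have t00 : 0 < t0 by rewrite !mulr_gt0.
have bad := card_bad_sample_le n0 m0 K0 sA AK GE t00.
set g := sample_good A G t0 in bad *; set T := #|{: m.-tuple 'I_n}| in bad *.
(* The radius [5/8 eps gam] gives [25/64 * 16 = 25/4], just above the 6 of the exponential bound. *)
have expo : ln (2 * p%:R / delta) <= m%:R * t0 ^+ 2 / (6 * K ^+ 2).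
  rewrite ler_pdivlMr ?mulr_gt0 ?exprn_gt0 //.
  move: hm; rewrite ler_pdivrMr ?mulr_gt0 ?exprn_gt0 // => hm.
  have -> : m%:R * t0 ^+ 2 = 25 / 64 * (m%:R * (gam ^+ 2 * eps ^+ 2)) by rewrite /t0; field.
  have h25 : 0 <= 25 / 64 :> R by rewrite divr_ge0.
  apply: le_trans (ler_wpM2l h25 hm).
  have lK : 0 <= K ^+ 2 * ln (2 * p%:R / delta) by rewrite mulr_ge0 ?sqr_ge0 // ltW.
  rewrite [_ * (6 * _)]mulrCA -[16 * _ * _]mulrA [ln _ * _]mulrC.
  by move: (K ^+ 2 * ln _) lK; clear => y ?; lra.
have bd : #|[predC g]|%:R <= delta * T%:R.
  have bp : 0 < 2 * p%:R / delta by rewrite (lt_trans ltr01).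
  rewrite -(ler_pM2r bp).
  apply: le_trans (_ : #|[predC g]|%:R * expR (m%:R * t0 ^+ 2 / (6 * K ^+ 2)) <= _).
    by rewrite ler_wpM2l // -[leLHS]lnK ?posrE // ler_expR.
  apply: le_trans bad _; rewrite le_eqVlt; apply/orP; left; apply/eqP; field.
  by rewrite gt_eqF.
have : (#|g| + #|[predC g]|)%N = T by exact: cardC.
move/(congr1 (fun k => k%:R : R)); rewrite natrD => e.
rewrite mulrBl mul1r lerBlDr -e lerD2l.
by move: bd; rewrite -e.
Qed.

(** Independence across iterations in counting form: both cardinals are products over the index set,
    compared factor by factor. *)
Lemma card_family_ge (k : nat) (T : 'I_k -> finType) (P : forall i, pred (T i)) (c : R) :
  0 <= c -> (forall i, c * #|T i|%:R <= #|P i|%:R) ->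
  c ^+ k * #|{dffun forall i, T i}|%:R <=
    #|(family P : pred {dffun forall i, T i})|%:R.
Proof.
move=> c0 h; rewrite card_family card_dep_ffun.
rewrite /image_mem -{1}(size_enum_ord k); elim: (enum _) => [|i s IH] /=.
  by rewrite mul1r.
by rewrite exprS !natrM mulrACA ler_pM // mulr_ge0 // exprn_ge0.
Qed.

End SampleSize.

(** * Probability of the good events and induction over the iterations *)

Theorem theorem8 (R : realType) (p n : nat) (hp : (0 < p)%N) (hn : (0 < n)%N)
  (f : 'I_n -> 'cV[R]_p -> R) (D X : set 'cV[R]_p)
  (hDopen : open D) (hDconv : convex_in D) (hXconv : convex_in X)
  (hf : forall i, twice_diff_on D (f i))
  (xs : 'cV[R]_p) (hxs : local_min_on (D `&` X) (Favg f) xs)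
  (* (LipS) *)
  (L : R) (hL : 0 < L)
  (hLip : forall x i, D x -> X x ->
     specnorm (Hess (f i) x - Hess (f i) xs) <= L * enorm (x - xs))
  (* SCS-star ; SmS-star is automatic since K-star is a finite maximum *)
  (hgam : 0 < gammastar f xs)
  (delta epsilon epsilon0 : R)
  (hdelta : 0 < delta < 1) (heps : 0 < epsilon < 1) (heps0 : 0 < epsilon0 < 1)
  (hepsilon6 : epsilon <= 6^-1)
  (k0 : nat) (hk0 : (1 <= k0)%N)
  (s0 s : nat -> nat)
  (hs0 : forall k : 'I_k0,
     16 * Kstar f xs ^+ 2 * ln (2 * p%:R / delta)
       / (gammastar f xs ^+ 2 * epsilon0 ^+ 2) <= (s0 k)%:R)
  (hs : forall k : 'I_k0,
     16 * Kstar f xs ^+ 2 * ln (2 * p%:R / delta)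
       / (gammastar f xs ^+ 2 * epsilon ^+ 2) <= (s k)%:R)
  (x0 : 'cV[R]_p) (hx0D : D x0) (hx0X : X x0)
  (hx0 : enorm (x0 - xs) < gammastar f xs / (6 * (Num.sqrt p%:R + 2^-1) * L))
  (lam : nat -> Omega n k0 s0 s -> R)
  (x : nat -> Omega n k0 s0 s -> 'cV[R]_p)
  (hxinit : forall w, x 0%N w = x0)
  (* x^(k) only depends on the samples of iterations < k *)
  (hxadapt : forall (k : nat) (w w' : Omega n k0 s0 s),
     (forall j : 'I_k0, (j < k)%N -> w j = w' j) -> x k w = x k w')
  (* lambda^(k) only depends on the samples of iterations < k and on S_0 of iteration k *)
  (hlamadapt : forall (k : 'I_k0) (w w' : Omega n k0 s0 s),
     (forall j : 'I_k0, (j < k)%N -> w j = w' j) -> (w k).1 = (w' k).1 ->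
     lam k w = lam k w')
  (* threshold condition at every iteration *)
  (hlam : forall (k : 'I_k0) (w : Omega n k0 s0 s),
     ((6 * Num.sqrt p%:R + 3) * (1 - epsilon)) / ((6 * Num.sqrt p%:R + 2) * (1 - epsilon0))
       * lmin (subHess f (w k).1 (x k w)) < lam k w)
  (* the update with g = grad F(x^(k)), M = P(lambda^(k); H(x^(k))), alpha_k = 1 *)
  (hupd : forall (k : 'I_k0) (w : Omega n k0 s0 s),
     exists M : 'M[R]_p,
       spec_reg (lam k w) (subHess f (w k).2 (x k w)) M /\
       is_argmin (D `&` X)
         (qmodel (Favg f (x k w)) (x k w) (grad (Favg f) (x k w)) M)
         (x k.+1 w)) :
  (1 - delta) ^+ (2 * k0) <=
    #|[pred w : Omega n k0 s0 s | [forall k : 'I_k0,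
        enorm (x k.+1 w - xs)
          <= (1 - gammastar f xs / (2 * lam k w)) * enorm (x k w - xs)]]|%:R
    / #|Omega n k0 s0 s|%:R.
Proof.
have [[Dxs _] _] := hxs.
set gam := gammastar f xs in hgam hs0 hs hx0 *; set K := Kstar f xs in hs0 hs.
pose A i := Hess (f i) xs; pose G := Hess (Favg f) xs.
have nR : n%:R != 0 :> R by rewrite pnatr_eq0 -lt0n.
have sA i : (A i)^T = A i by exact: Hess_sym hDopen (hf i) Dxs.
have AK i : form_le (A i) K.
  apply: form_le_specnorm; exact: (le_bigmax _ (fun i => specnorm (Hess (f i) xs))).
have GE : n%:R *: G = \sum_i A i by rewrite /G (Hess_Favg hDopen hf Dxs) scalerA mulfV // scale1r.
have GK : form_le G K by rewrite /G (Hess_Favg hDopen hf Dxs); exact: form_le_avg.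
have K0 : 0 < K by apply: form_le_gt0 hp hgam _ GK => v;
  exact/lmin_le_form/(Hess_Favg_sym hDopen hf Dxs).
have [/andP[e0 e1] /andP[d0 d1]] := (heps, hdelta); have /andP[e00 e01] := heps0.
have good0 (k : 'I_k0) := card_good_sample_ge hp hn K0 hgam e00 hdelta sA AK GE (hs0 k).
have good (k : 'I_k0) := card_good_sample_ge hp hn K0 hgam e0 hdelta sA AK GE (hs k).
pose P (k : 'I_k0) : pred ((s0 k).-tuple 'I_n * (s k).-tuple 'I_n)%type := fun z =>
  sample_good A G (5 / 8 * epsilon0 * gam) z.1 && sample_good A G (5 / 8 * epsilon * gam) z.2.
have dm : 0 <= 1 - delta by rewrite subr_ge0 ltW.
(* The two independent samples of an iteration contribute [(1 - delta)^2], hence the exponent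
   [2 * k0]. *)
have cardP : (1 - delta) ^+ (2 * k0) * #|Omega n k0 s0 s|%:R <=
    #|(family P : pred (Omega n k0 s0 s))|%:R.
  rewrite exprM; apply: card_family_ge => [|k]; first exact: exprn_ge0.
  have -> : #|P k| =
      (#|[pred S : (s0 k).-tuple 'I_n | sample_good A G (5 / 8 * epsilon0 * gam) S]| *
      #|[pred S : (s k).-tuple 'I_n | sample_good A G (5 / 8 * epsilon * gam) S]|)%N.
    by rewrite -cardX; apply: eq_card => -[? ?].
  rewrite card_prod !natrM expr2 mulrACA.
  by apply: ler_pM; rewrite ?mulr_ge0 //; [case: (good0 k) | case: (good k)].
(* Constant samples show that the outcome space is nonempty, so the quotient by its cardinal is a
   genuine probability. *)
have O0 : 0 < #|Omega n k0 s0 s|%:R :> R.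
  rewrite ltr0n; apply/card_gt0P.
  pose w0 (k : 'I_k0) : (s0 k).-tuple 'I_n * (s k).-tuple 'I_n :=
    ([tuple Ordinal hn | _ < s0 k], [tuple Ordinal hn | _ < s k]).
  by exists (finfun w0).
rewrite ler_pdivlMr //; apply: le_trans cardP _; rewrite ler_nat.
apply: subset_leq_card; apply/fintype.subsetP => w /familyP wP; rewrite inE.
(* The initial radius condition with its denominator cleared and made non-strict: the invariant of
   the induction. *)
pose small y := L * enorm (y - xs) * (6 * Num.sqrt p%:R + 3) <= gam.
have step (k : 'I_k0) : D (x k w) -> X (x k w) -> small (x k w) ->
   [/\ D (x k.+1 w), X (x k.+1 w), small (x k.+1 w) &
   enorm (x k.+1 w - xs) <= (1 - gam / (2 * lam k w)) * enorm (x k w - xs)].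
  move=> Dx Xx sx; have [M [hM hmin]] := hupd k w.
  have /andP[/asboolP g0 /asboolP g1] := wP k.
  have [m00 _] := good0 k; have [m10 _] := good k.
  have [lamk contr] := newton_step_contraction hp hn hL hDopen hDconv hXconv hf hxs hLip
    (erefl gam) hgam e0 hepsilon6 heps0 m00 m10 Dx Xx sx g0 g1 (hlam k w) hM hmin.
  have [[Dn Xn] _] := hmin; split=> //.
  have lam0 : 0 < lam k w by apply: lt_trans lamk; rewrite mulr_gt0 // subr_gt0.
  apply: le_trans sx; rewrite /small.
  apply: ler_wpM2r; first by rewrite addr_ge0 // mulr_ge0 // sqrtr_ge0.
  apply: ler_wpM2l; first exact: ltW.
  apply: le_trans contr _; rewrite ler_piMl ?enorm_ge0 // gerBl divr_ge0 ?mulr_ge0 ?ltW //.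
have inv (k : nat) : (k <= k0)%N -> [/\ D (x k w), X (x k w) & small (x k w)].
  elim: k => [_|k IH kk].
    rewrite hxinit; split=> //; rewrite /small.
    move: hx0; rewrite ltr_pdivlMr; last first.
      by rewrite !mulr_gt0 // ltr_wpDl ?sqrtr_ge0 // invr_gt0.
    move/ltW; congr (_ <= _); move: (enorm _) (Num.sqrt _) => a b; by field.
  have [Dx Xx sx] := IH (ltnW kk).
  by have [] := step (Ordinal kk) Dx Xx sx.
apply/forallP => k; have [Dx Xx sx] := inv k (ltnW (ltn_ord k)).
by have [] := step k Dx Xx sx.
Qed.
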